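(* Suppose that one of the following two conditions holds: (a) $(\mathcal X,d)$ is a separable metric space and all densities $f_b$, $b\in\Theta$, are continuous on $\mathcal X$; or (b) $\mathcal X=\mathbb R^q$ and $d(x,y)=\|x-y\|$ for some norm $\|\cdot\|$ on $\mathbb R^q$. Let $k=k(n)$ satisfy $k(n)\to\infty$ and $k(n)/n\to0$. For $\theta\in\Theta$ let $T_\theta(x,\mathcal D):=-\widehat w_\theta(x,\mathcal D)$ be the $k$-nearest-neighbor statistic with prior weight estimators $\widehat w_b=N_b/n$, that is, $$\widehat w_\theta(x,\mathcal D)=\frac{\#\{i\in\mathcal G_\theta:d(X_i,x)\le\widehat r_k(x)\}}{\#\{i\le n:d(X_i,x)\le\widehat r_k(x)\}}.$$ Then $$T_\theta(X,\mathcal D)\to_p T_\theta^o(X)\qquad\text{with}\qquad T_\theta^o=T_\theta^*.$$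
   Context: Setting. $\Theta=\{1,\dots,L\}$ with $L\ge2$. $(X,Y)$ is a random pair in $\mathcal X\times\Theta$ with prior probabilities $w_b:=\mathbb P(Y=b)$ and conditional distributions $P_b:=\mathcal L(X\,|\,Y=b)$, where $\mathcal L(\cdot)$ denotes the distribution of a random variable. The distributions $P_1,\dots,P_L$ have densities $f_1,\dots,f_L>0$ with respect to some measure $M$ on $\mathcal X$. Put $$T_\theta^*(x):=\sum_{b\ne\theta}w_{b,\theta}\,\frac{f_b(x)}{f_\theta(x)},\qquad w_{b,\theta}:=\frac{w_b}{\sum_{c\ne\theta}w_c}.$$ It is assumed throughout that for each $\theta\in\Theta$ the likelihood ratio $T_\theta^*(X)$ has a continuous distribution (one without atoms). Training data. $\mathcal D$ consists of $(X_1,Y_1),\dots,(X_n,Y_n)$, where the labels $Y_1,\dots,Y_n\in\Theta$ are regarded as fixed (non-random), $X_1,\dots,X_n$ and $(X,Y)$ are independent, and $\mathcal L(X_i)=P_{Y_i}$. Put $\mathcal G_b:=\{i\le n:Y_i=b\}$ and $N_b:=\#\mathcal G_b>0$. Nearest neighbors. $B(x,r):=\{y\in\mathcal X:d(x,y)\le r\}$, and for a positive integer $k\le n$, $$\widehat r_k(x)=\widehat r_k(x,\mathcal D):=\min\{r\ge0:\#\{i\le n:X_i\in B(x,r)\}\ge k\}.$$ The number $k=k(n)$ is determined by the group sizes $N_1,\dots,N_L$ only. Asymptotics. Statements are meant as $n\to\infty$ with $N_b/n\to w_b$ for all $b\in\Theta$; $\to_p$ denotes convergence in probability (of the difference to 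$0$).
   Formalization: Since T_θ ≤ 0 < T_θ^*, the limit cannot be T_θ^* itself; the formal statement proves convergence to h(T_θ^*(X)) = −w_θf_θ(X)/Σ_b w_b f_b(X), with h strictly increasing on (0,∞). *)

(* Defs.v *)
From HB Require Import structures.
From mathcomp Require Import all_boot all_order all_algebra.
From mathcomp Require Import all_classical all_reals all_analysis.
Import Order.TTheory GRing.Theory Num.Theory.
Import numFieldNormedType.Exports.

Set Implicit Arguments.
Unset Strict Implicit.
Unset Printing Implicit Defensive.

Local Open Scope classical_set_scope.
Local Open Scope ring_scope.

(* MathComp-Analysis requires measurable spaces to be pointed; a space that
   carries a random element is nonempty, so this costs no generality. *)
#[short(type="pmetricType")]
HB.structure Definition PMetric (R : numDomainType) :=
  { S of Metric R S & Pointed S }.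

Definition borel (S : ptopologicalType) := g_sigma_algebraType (@open S).

Definition separable (S : topologicalType) : Prop :=
  exists2 D : set S, countable D & dense D.

Record is_norm (R : realType) (V : lmodType R) (N : V -> R) : Prop := IsNorm {
  norm_triangle : forall x y, N (x + y) <= N x + N y ;
  norm_homogeneous : forall (a : R) x, N (a *: x) = `|a| * N x ;
  norm_definite : forall x, N x = 0 -> x = 0 }.

(* A disjunction of two conditions on the space S, its distance and the
   densities. It is an inductive family, not a disjunction of propositions,
   because each alternative determines the space itself: a separable metric
   space with its own distance, or R^q with the distance of some norm. *)
Inductive feature_space (R : realType) (L : nat) :
    forall S : ptopologicalType, (S -> S -> R) -> ('I_L -> S -> R) -> Prop :=
| metric_space (S : pmetricType R) (f : 'I_L -> S -> R) :
    separable S -> (forall b, continuous (f b)) ->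
    feature_space (fun x y : S => mdist x y) f
| normed_space (q : nat) (N : 'rV[R]_q -> R) (f : 'I_L -> 'rV[R]_q -> R) :
    is_norm N ->
    feature_space (fun x y : 'rV[R]_q => N (x - y)) f.

Section nearest_neighbors.
Context {R : realType} {S : Type} (dist : S -> S -> R).
Context {n : nat} (xs : 'I_n -> S).

(* The minimum of this set exists as soon as k <= n, and is then its inf. *)
Definition knn_radius (k : nat) (x : S) : R :=
  inf [set r : R | 0 <= r /\
                   (k <= #|[pred i : 'I_n | (dist x (xs i) <= r)%R]|)%N].

Definition knn_weight (L : nat) (lab : 'I_n -> 'I_L) (k : nat) (theta : 'I_L)
    (x : S) : R :=
  #|[pred i : 'I_n | (lab i == theta) &&
                     (dist (xs i) x <= knn_radius k x)]|%:R
  / #|[pred i : 'I_n | dist (xs i) x <= knn_radius k x]|%:R.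

Definition knn_statistic (L : nat) (lab : 'I_n -> 'I_L) (k : nat)
    (theta : 'I_L) (x : S) : R := - knn_weight lab k theta x.

End nearest_neighbors.

Definition group_size (n L : nat) (lab : 'I_n -> 'I_L) (b : 'I_L) : nat :=
  #|[pred i : 'I_n | lab i == b]|.

Section class_distributions.
Context {R : realType} {d : measure_display} {Omega : measurableType d}.
Context (P : probability Omega R).
Context {L : nat} (Y : Omega -> 'I_L).

Definition prior (b : 'I_L) : R := fine (P (Y @^-1` [set b])).

Definition class_law {S : Type} (X : Omega -> S) (b : 'I_L) (A : set S)
    : \bar R :=
  (fine (P (X @^-1` A `&` Y @^-1` [set b])) / prior b)%:E.

Definition cvg_in_probability (Z : nat -> Omega -> R) (W : Omega -> R) : Prop :=
  forall eps : R, 0 < eps ->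
    P [set omega | eps <= `|Z n omega - W omega|] @[n --> \oo] --> 0%E.

(* Mutual independence of xs 0, ..., xs (n-1) and the pair (X, Y). As Theta is
   finite with the discrete sigma-algebra, the measurable subsets of S * Theta
   are the sets {(x, b) | x in B b} with all the sections B b measurable.
   Sub-families are covered by taking some of the sets to be the full space. *)
Definition sample_independent {d' : measure_display} {S : measurableType d'}
    (X : Omega -> S) (n : nat) (xs : 'I_n -> Omega -> S) : Prop :=
  forall (A : 'I_n -> set S) (B : 'I_L -> set S),
    (forall i, measurable (A i)) -> (forall b, measurable (B b)) ->
    P ((\bigcap_i (xs i @^-1` A i)) `&` [set omega | B (Y omega) (X omega)])
    = ((\prod_(i < n) P (xs i @^-1` A i))
       * P [set omega | B (Y omega) (X omega)])%E.

End class_distributions.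

Section likelihood_ratio.
Context {R : realType} {L : nat} {S : Type}.
Context (w : 'I_L -> R) (f : 'I_L -> S -> R).

Definition rel_weight (b theta : 'I_L) : R :=
  w b / \sum_(c < L | c != theta) w c.

Definition Tstar (theta : 'I_L) (x : S) : R :=
  \sum_(b < L | b != theta) rel_weight b theta * (f b x / f theta x).

(* The conditional probability of class theta given the feature x. With
   c := \sum_(b | b != theta) w b, it equals
   w theta / (w theta + c * Tstar theta x), so that - posterior is a strictly
   increasing function of Tstar. *)
Definition posterior (theta : 'I_L) (x : S) : R :=
  w theta * f theta x / \sum_(b < L) w b * f b x.

End likelihood_ratio.

(* Main.v *)
Require Import Defs.
From HB Require Import structures.
From mathcomp Require Import all_boot all_order all_algebra.
From mathcomp Require Import all_classical all_reals all_analysis.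
From mathcomp Require Import measurable_realfun.
From mathcomp Require finmap.
From mathcomp Require Import ring lra.
Import Order.TTheory GRing.Theory Num.Theory.
Import numFieldNormedType.Exports.

(** The weight of class [theta] among the [k] nearest neighbors of [X] is close
    to the posterior probability [u X] of that class given [X], because the
    neighbors fill a small ball about [X], on which the class frequency is the
    average of [u].

    Let [mu] be the law of [X], let [p] be slightly larger than [k / n], and let
    [r x] be the smallest radius of a closed ball about [x] of mass at least
    [p] ([qradius]). The random nearest neighbor ball is compared with the open
    and the closed ball of the nonrandom radius [r X]. For a ball that does
    not depend on the sample, the number of sample points in it, and the number
    of those of class [theta], have variance at most their expectation, so that
    by Chebyshev they differ from their expectations by at most [delta] times
    the larger of [k] and the expected number of points ([hits_concentration]).
    Hence the closed ball contains [k] points, and the nearest neighbor radius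
    is at most [r X]. If it is equal to [r X], the neighbors are the points of the closed ball; if it is smaller,
    they are almost all the points of the open ball. In both cases the class
    ratio is that of a nonrandom ball ([knn_weight_close]), and this one is
    close to the [mu]-average of [u] over the ball.

    It remains to see that this average is close to [u X], that is, that the
    mean oscillation of [u] over the balls tends to [0] in mean as [p] tends to
    [0] ([mean_oscillation_cvg0]). If the densities are continuous, so is [u],
    and the balls about a point of the support shrink to that point. In [R^q]
    with a norm, [u] is approximated in mean by continuous functions
    ([approx_continuous_measurable]), and the error is controlled by an
    inequality of maximal type: for every [y], the centers other than [y]
    whose balls contain [y] form a set of mass at most a constant times [p]
    ([norm_bounded_overlap]). For this the space is cut into finitely many cones with apex [y], so narrow
    that inside a cone two points are closer to each other than the farther one
    is to [y] ([cone_closer]). The ball of a far center then contains all the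
    nearer centers of the same cone in its interior, of mass at most [p].

    The convergence in probability also requires the events to be measurable,
    which separability of the feature space ensures ([measurable_dist]). *)

Set Implicit Arguments.
Unset Strict Implicit.
Unset Printing Implicit Defensive.

Local Open Scope classical_set_scope.
Local Open Scope ring_scope.

(** The order on the reals is reached through several convertible structures,
    depending on the shape of the compared terms; [lra] expects a single one. *)
Ltac rlra :=
  match goal with R : realType |- _ =>
    let T := constr:(reals_Real__to__Order_Preorder R) in
    repeat match goal with
    | |- context [@Order.lt ring_display ?T'] =>
      lazymatch T' with T => fail | _ =>
        change (@Order.lt ring_display T') with (@Order.lt ring_display T) end
    | |- context [@Order.le ring_display ?T'] =>
      lazymatch T' with T => fail | _ =>
        change (@Order.le ring_display T') with (@Order.le ring_display T) end
    | H : context [@Order.lt ring_display ?T'] |- _ =>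
      lazymatch T' with T => fail | _ =>
        change (@Order.lt ring_display T') with (@Order.lt ring_display T) in H end
    | H : context [@Order.le ring_display ?T'] |- _ =>
      lazymatch T' with T => fail | _ =>
        change (@Order.le ring_display T') with (@Order.le ring_display T) in H end
    end
  end; lra.

(** * Separable metric spaces and their Borel sets *)

(** Inversion is [expR (- ln t)] on the positive reals. *)
Lemma measurable_funV_gt0 d (T : measurableType d) (R : realType) (f : T -> R) :
  (forall x, 0 < f x) -> measurable_fun setT f ->
  measurable_fun setT (fun x => (f x)^-1).
Proof.
move=> f0 mf; rewrite (_ : (fun x => _) = expR \o (\- (@ln R \o f))); last first.
  by apply/funext => x /=; rewrite expRN lnK// posrE.
apply: measurableT_comp; first exact: measurable_expR.
by apply: measurable_funN; apply: measurableT_comp => //; exact: measurable_ln.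
Qed.

Definition rad (R : realType) (m : nat) : R := m.+1%:R^-1.
Arguments rad {R} m.

Lemma rad_gt0 (R : realType) (m : nat) : 0 < rad m :> R.
Proof. by rewrite invr_gt0. Qed.

Lemma rad_lt (R : realType) (e : R) : 0 < e -> exists m, rad m < e.
Proof.
move=> e0; have [m _ /(_ m (leqnn m)) /= me] := near_infty_natSinv_lt (PosNum e0).
by exists m.
Qed.

(** What the proof uses about the feature space, in a form shared by a metric
    space with its own distance and by [R^q] with the distance of a norm that
    is not the one defining its topology. The dense sequence is separability. *)
Record metrizes (R : realType) (S : ptopologicalType) (dist : S -> S -> R)
    : Prop := Metrizes {
  dist_self : forall x, dist x x = 0 ;
  dist_eq0 : forall x y, dist x y = 0 -> x = y ;
  dist_sym : forall x y, dist x y = dist y x ;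
  dist_triangle : forall x y z, dist x z <= dist x y + dist y z ;
  oball_open : forall x (r : R), open [set y | dist x y < r] ;
  open_has_oball : forall (U : set S) x, open U -> U x ->
    exists2 r : R, 0 < r & [set y | dist x y < r] `<=` U ;
  dist_dense : exists q : nat -> S,
    forall x (r : R), 0 < r -> exists n, dist (q n) x < r }.

Lemma countable_enum (S : pointedType) (D : set S) : countable D ->
  exists q : nat -> S, forall x, D x -> exists n, q n = x.
Proof.
move=> /countable_injP[g ginj].
exists (fun n => xget point [set x | D x /\ g x = n]) => x Dx; exists (g x).
case: xgetP => [y _ [Dy gyx]|/(_ x)]; last by case.
by apply: ginj; rewrite ?inE.
Qed.

Section metric_borel.
Context {R : realType} {S : ptopologicalType} (dist : S -> S -> R).
Hypothesis Hd : metrizes dist.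

Lemma dist_ge0 x y : 0 <= dist x y.
Proof.
have := dist_triangle Hd x y x; rewrite (dist_self Hd) (dist_sym Hd y x).
by rewrite -mulr2n pmulrn_lge0.
Qed.

Lemma dist_continuous x : continuous (dist x).
Proof.
move=> y; apply/cvgrPdist_lt => e e0.
have : nbhs y [set z | dist y z < e].
  apply: open_nbhs_nbhs; split; first exact: oball_open.
  by rewrite /= (dist_self Hd).
apply: filterS => z /= yz; rewrite ltr_norml.
have h1 := dist_triangle Hd x y z; have h2 := dist_triangle Hd x z y.
by rewrite (dist_sym Hd z y) in h2; apply/andP; split; lra.
Qed.

Lemma open_borel (U : set S) : open U -> measurable (U : set (borel S)).
Proof. by move=> oU; apply: sub_gen_smallest. Qed.

Lemma continuous_borel (f : S -> R) : continuous f ->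
  measurable_fun setT (f : borel S -> R).
Proof.
move=> cf; apply: (measurability _ (RGenOpens.measurableE R)).
move=> _ [_ [a [b -> <-]]]; rewrite setTI; apply: open_borel.
by move/continuousP: cf; apply; exact: interval_open.
Qed.

(** Separability is essential here: [dist x y] is the infimum over a dense
    sequence of [dist q x + dist q y], so that the distance is measurable for
    the product of the Borel sigma-algebras, which may be smaller than the
    Borel sigma-algebra of the product. *)
Lemma measurable_dist :
  measurable_fun setT (fun z : borel S * borel S => dist z.1 z.2).
Proof.
have [q qd] := dist_dense Hd.
apply: (measurability _ (RGenInftyO.measurableE R)).
move=> _ [_ [t ->] <-]; rewrite setTI.
rewrite (_ : _ @^-1` _ = \bigcup_n
    [set z : borel S * borel S | dist (q n) z.1 + dist (q n) z.2 < t]).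
  apply: bigcupT_measurable => n.
  rewrite (_ : [set z | _] = (fun z : borel S * borel S =>
    dist (q n) z.1 + dist (q n) z.2) @^-1` `]-oo, t[%classic); last first.
    by apply/seteqP; split => z /=; rewrite in_itv.
  rewrite -[X in measurable X]setTI.
  have mq : measurable_fun setT (dist (q n) : borel S -> R).
    by apply: continuous_borel; exact: dist_continuous.
  apply: (measurable_funD _ _ measurableT) => //.
  - by apply: (measurableT_comp mq); exact: measurable_fst.
  - by apply: (measurableT_comp mq); exact: measurable_snd.
apply/seteqP; split => -[x y] /=.
- rewrite in_itv/= => xyt.
  have e0 : 0 < (t - dist x y) / 2 by rewrite divr_gt0// subr_gt0.
  have [n qn] := qd x _ e0; exists n => //=.
  by have := dist_triangle Hd (q n) x y; move: qn; rlra.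
- move=> [n _ /=]; rewrite in_itv/=.
  by have := dist_triangle Hd x (q n) y; rewrite (dist_sym Hd x (q n)); rlra.
Qed.

Lemma measurable_dist_comp d (T : measurableType d) (g h : T -> borel S) :
  measurable_fun setT g -> measurable_fun setT h ->
  measurable_fun setT (fun t => dist (g t) (h t)).
Proof.
move=> mg mh; apply: (measurableT_comp measurable_dist (g := fun t => (g t, h t))).
exact: measurable_fun_pair.
Qed.

Lemma measurable_setlt d (T : measurableType d) (g h : T -> R) :
  measurable_fun setT g -> measurable_fun setT h ->
  measurable [set t | g t < h t].
Proof.
move=> mg mh; rewrite -[X in measurable X]setTI.
by apply: (measurable_fun_ltr mg mh measurableT (Y := [set true])).
Qed.

Lemma measurable_setle d (T : measurableType d) (g h : T -> R) :
  measurable_fun setT g -> measurable_fun setT h ->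
  measurable [set t | g t <= h t].
Proof.
move=> mg mh; rewrite -[X in measurable X]setTI.
by apply: (measurable_fun_ler mg mh measurableT (Y := [set true])).
Qed.

Definition support (mu : set (borel S) -> \bar R) : set S :=
  [set x | forall r : R, 0 < r -> (0 < mu [set y | (dist x y < r)%R])%E].

Lemma measurable_ball_lt (x : S) r :
  measurable ([set y | dist x y < r] : set (borel S)).
Proof. by apply: open_borel; exact: oball_open. Qed.

Lemma measurable_ball_le (x : S) r :
  measurable ([set y | dist x y <= r] : set (borel S)).
Proof.
apply: (@measurable_setle _ (borel S)).
  by apply: continuous_borel; exact: dist_continuous.
exact: measurable_cst.
Qed.

(** The complement of the support is covered by the null balls with center in
    the dense sequence and radius [rad m], and there are countably many. *)
Lemma ae_support (mu : {measure set (borel S) -> \bar R}) :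
  {ae mu, forall x, support mu x}.
Proof.
have [q qd] := dist_dense Hd.
pose V (nm : nat * nat) : set (borel S) :=
  [set y | dist (q nm.1) y < rad nm.2].
pose W n := if unpickle n is Some nm then
  if mu (V nm) == 0%E then V nm else set0 else set0.
apply: (@negligibleS _ _ _ _ (\bigcup_n W n)) => [x /=|]; last first.
  apply: negligible_bigcup => n; rewrite /W; case: unpickle => [nm|]; last first.
    exact: negligible_set0.
  case: eqP => [V0|_]; last exact: negligible_set0.
  by exists (V nm); split => //; exact: measurable_ball_lt.
move=> /existsNP[r /not_implyP[r0 /negP]]; rewrite -leNgt => mur.
have [m mr] : exists m, rad m < r / 2 by apply: rad_lt; rewrite divr_gt0.
have [n qnx] := qd x (rad m) (rad_gt0 R m).
exists (pickle (n, m)) => //; rewrite /W pickleK ifT//.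
rewrite eq_le measure_ge0 andbT; apply: le_trans mur.
apply: le_measure; rewrite ?inE; [exact: measurable_ball_lt..|].
rewrite /V => y /= qy; have := dist_triangle Hd x (q n) y.
rewrite (dist_sym Hd x (q n)); move: mr qy qnx; rlra.
Qed.

End metric_borel.

(** * Balls of prescribed mass *)

Lemma measure_bigcup_le d (T : measurableType d) (R : realType)
    (mu : {measure set T -> \bar R}) (F : nat -> set T) (c : \bar R) :
  (forall n, measurable (F n)) -> nondecreasing_seq F ->
  (forall n, mu (F n) <= c)%E -> (mu (\bigcup_n F n) <= c)%E.
Proof.
move=> mF ndF Fc; apply: (cvge_le (f := mu \o F) (F := \oo)).
  by near=> n; exact: Fc.
by apply: nondecreasing_cvg_mu => //; exact: bigcupT_measurable.
Unshelve. all: by end_near. Qed.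

Section quantile_radius.
Context {R : realType} {S : ptopologicalType} (dist : S -> S -> R).
Hypothesis Hd : metrizes dist.

Definition cball (x : S) (r : R) : set (borel S) := [set y | dist x y <= r].

Definition oball (x : S) (r : R) : set (borel S) := [set y | dist x y < r].

Lemma oball_bigcup (x : S) (r : R) :
  oball x r = \bigcup_m cball x (r - rad m).
Proof.
apply/seteqP; split => y; rewrite /oball /cball /=.
  rewrite -subr_gt0 => /rad_lt[m me].
  by exists m => //; rewrite /= lerBrDr -lerBrDl; exact: ltW.
by move=> [m _ /=]; have := rad_gt0 R m; rlra.
Qed.

Lemma cball_nondecreasing (x : S) (r : R) :
  nondecreasing_seq (fun m => cball x (r - rad m)).
Proof.
move=> m n mn; apply/subsetPset => y /= /le_trans; apply.
by rewrite lerD2l lerN2 /rad lef_pV2 ?posrE// ler_nat.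
Qed.

Context (mu : probability (borel S) R).

(** The population analogue of the nearest neighbor radius: with [p] about
    [k / n], the ball about [x] of radius [qradius p x] is expected to contain
    about [k] of the [n] points, up to the mass of its boundary sphere. *)
Definition qradius (p : R) (x : S) : R :=
  inf [set r : R | 0 <= r /\ (p%:E <= mu (cball x r))%E].

Lemma le_cball (x : S) (r s : R) : r <= s -> (mu (cball x r) <= mu (cball x s))%E.
Proof.
move=> rs; apply: le_measure; rewrite ?inE; [exact: measurable_ball_le..|].
by move=> y /le_trans; apply.
Qed.

Context (p : R).

(** Continuity from above of a finite measure. *)
Lemma cball_mass_ge (x : S) (r : R) :
  (forall e : R, 0 < e -> (p%:E <= mu (cball x (r + e)))%E) ->
  (p%:E <= mu (cball x r))%E.
Proof.
move=> pr.
have E : cball x r = \bigcap_m cball x (r + rad m).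
  apply/seteqP; split => y /=; rewrite /cball /=.
    by move=> xyr m _ /=; have := rad_gt0 R m; rlra.
  move=> H; apply/ler_addgt0Pr => e e0.
  have [m me] := rad_lt e0.
  by apply: le_trans (H m I) _; rewrite lerD2l ltW.
have mE m : measurable (cball x (r + rad m)) by exact: measurable_ball_le.
rewrite E; have cv : mu (cball x (r + rad n)) @[n --> \oo] -->
    mu (\bigcap_m cball x (r + rad m)).
  apply: nonincreasing_cvg_mu => //.
  - by rewrite (le_lt_trans (probability_le1 _ _))// ltry.
  - exact: bigcapT_measurable.
  - move=> m n mn; apply/subsetPset => y /= /le_trans; apply.
    by rewrite lerD2l /rad lef_pV2 ?posrE// ler_nat.
rewrite -(cvg_lim _ cv)//; apply: lime_ge; first by apply/cvg_ex; eexists; exact: cv.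
by near=> m; apply: pr; exact: rad_gt0.
Unshelve. all: by end_near. Qed.

Lemma qradius_set_nonempty (x : S) : p < 1 ->
  exists r : R, 0 <= r /\ (p%:E <= mu (cball x r))%E.
Proof.
move=> p1; apply: contrapT => /forallNP H.
suff : (1 <= p%:E)%E by rewrite lee_fin leNgt p1.
have <- : mu (\bigcup_m cball x m%:R) = 1%E.
  rewrite -(probability_setT mu); congr (mu _); apply/seteqP; split => // y _.
  by exists (Num.truncn (dist x y)).+1 => //=; rewrite /cball/= ltW// truncnS_gt.
apply: measure_bigcup_le => [m|m n mn|m]; first exact: measurable_ball_le.
- by apply/subsetPset => y /= /le_trans; apply; rewrite ler_nat.
- by rewrite leNgt; apply/negP => /ltW pm; apply: (H m%:R).
Qed.

Hypothesis p1 : p < 1.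

Lemma qradius_ge0 (x : S) : 0 <= qradius p x.
Proof. by apply: lb_le_inf; [exact: qradius_set_nonempty|move=> r []]. Qed.

Lemma qradius_le (x : S) (r : R) : 0 <= r -> (p%:E <= mu (cball x r))%E ->
  qradius p x <= r.
Proof. by move=> r0 pr; apply: ge_inf => //; exists 0 => s []. Qed.

(** With [oball_qradius], this brackets [p] between the masses of the open and of
    the closed ball; both are needed since the sphere may have positive mass. *)
Lemma cball_qradius (x : S) : (p%:E <= mu (cball x (qradius p x)))%E.
Proof.
apply: cball_mass_ge => e e0.
have [r [r0 pr] re] : exists2 r : R, 0 <= r /\ (p%:E <= mu (cball x r))%E &
    r < qradius p x + e.
  by apply: inf_adherent => //; split; [exact: qradius_set_nonempty|
    exists 0 => s []].
by apply: le_trans pr _; apply: le_cball; exact: ltW.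
Qed.

Lemma oball_qradius (x : S) : 0 <= p -> (mu (oball x (qradius p x)) <= p%:E)%E.
Proof.
move=> p0; rewrite oball_bigcup.
apply: measure_bigcup_le => [m||m]; first exact: measurable_ball_le.
- exact: cball_nondecreasing.
- have [r0|r0] := leP 0 (qradius p x - rad m).
    rewrite leNgt; apply/negP => /ltW /(qradius_le r0).
    by have := rad_gt0 R m; rlra.
  rewrite (_ : cball _ _ = set0) ?measure0 ?lee_fin//.
  rewrite -subset0 => y; rewrite /cball/= => h.
  by have := dist_ge0 Hd x y; move: r0 h; rlra.
Qed.

(** The event [qradius p x <= t] is [p <= mu (cball x t)] when [0 <= t], and the
    mass of a section is measurable. *)
Lemma measurable_qradius : measurable_fun setT (qradius p : borel S -> R).
Proof.
apply: (measurability _ (RGenOInfty.measurableE R)).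
move=> _ [_ [t ->] <-]; rewrite setTI.
rewrite (_ : _ @^-1` _ = ~` [set x : borel S | qradius p x <= t]); last first.
  by apply/seteqP; split => x /=; rewrite in_itv/= andbT ltNge => /negP.
apply: measurableC; have [t0|t0] := ltP t 0.
  rewrite (_ : mkset _ = set0) // -subset0 => x /=.
  by have := qradius_ge0 x; rlra.
rewrite (_ : mkset _ = [set: borel S] `&` [set x | (p%:E <=
    (mu \o xsection [set z : borel S * borel S | (dist z.1 z.2 <= t)%R]) x)%E]).
  apply: emeasurable_fun_c_infty => //; apply: measurable_fun_xsection.
  by apply: measurable_setle => //; exact: measurable_dist.
rewrite setTI; apply/seteqP; split => x /=; rewrite xsectionE.
  by move=> qt; apply: le_trans (cball_qradius x) _; exact: le_cball.
by move=> h; apply: qradius_le.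
Qed.

End quantile_radius.

(** * Averaging kernels and mean oscillation *)

Lemma cvge0P (R : realType) (f : nat -> \bar R) : (forall n, 0 <= f n)%E ->
  (forall e : R, 0 < e -> \forall n \near \oo, (f n <= e%:E)%E) ->
  f n @[n --> \oo] --> 0%E.
Proof.
move=> f0 fe; apply/fine_cvgP; split.
  have := fe 1 ltr01; apply: filterS => n fn1.
  by rewrite ge0_fin_numE// (le_lt_trans fn1)// ltry.
apply/cvgrPdist_le => e e0; near=> n.
have fne : (f n <= e%:E)%E by near: n; exact: fe.
rewrite sub0r normrN /= ger0_norm ?fine_ge0//.
have fn : f n \is a fin_num by rewrite ge0_fin_numE// (le_lt_trans fne)// ltry.
by rewrite -lee_fin fineK.
Unshelve. all: by end_near. Qed.

Lemma cvge0_near (R : realType) (f : nat -> \bar R) (e : R) :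
  f n @[n --> \oo] --> 0%E -> 0 < e -> \forall n \near \oo, (f n <= e%:E)%E.
Proof.
move=> /fine_cvgP[ffin /cvgrPdist_le f0] e0; near=> n.
have fn : f n \is a fin_num by near: n.
have : `|0 - fine (f n)| <= e by near: n; exact: f0.
rewrite sub0r normrN => h; rewrite -(fineK fn) lee_fin.
exact: le_trans (ler_norm _) h.
Unshelve. all: by end_near. Qed.

Section averaging.
Context {R : realType} {S : ptopologicalType} (dist : S -> S -> R).
Hypothesis Hd : metrizes dist.
Context (mu : probability (borel S) R).

(** That this quantity tends to [0] when [K] concentrates on the diagonal is a
    differentiation theorem in mean. *)
Definition mean_oscillation (K : borel S * borel S -> R) (u : S -> R) : \bar R :=
  (\int[mu]_x \int[mu]_y (K (x, y) * `|u y - u x|)%:E)%E.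

Definition approx_within (e : R) (u : S -> R) : Prop :=
  exists v : S -> R, [/\ continuous v, forall x, 0 <= v x <= 1
    & (\int[mu]_x (`|u x - v x|)%:E <= e%:E)%E].

Definition approx_continuous (u : S -> R) : Prop :=
  forall e : R, 0 < e -> approx_within e u.

Context (K : nat -> borel S * borel S -> R).
Hypothesis mK : forall n, measurable_fun setT (K n).
Hypothesis K_ge0 : forall n z, 0 <= K n z.
Hypothesis K_mass : forall n x, (\int[mu]_y (K n (x, y))%:E <= 1)%E.
Hypothesis K_local : forall x (r : R), support dist mu x -> 0 < r ->
  \forall n \near \oo, forall y, r <= dist x y -> K n (x, y) = 0.

Lemma measurable_osc n (u : S -> R) : measurable_fun setT (u : borel S -> R) ->
  measurable_fun setT (fun z => (K n z * `|u z.2 - u z.1|)%:E).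
Proof.
move=> mu_; apply/measurable_EFinP; apply: measurable_funM => //.
apply: measurableT_comp => //; apply: measurable_funB.
  by apply: (measurableT_comp mu_); exact: measurable_snd.
by apply: (measurableT_comp mu_); exact: measurable_fst.
Qed.

(** At a point of the support the kernels concentrate near [x], where a
    continuous [u] oscillates little; dominated convergence concludes. *)
Lemma mean_oscillation_continuous (u : S -> R) :
  continuous u -> (forall x, 0 <= u x <= 1) ->
  mean_oscillation (K n) u @[n --> \oo] --> 0%E.
Proof.
move=> cu u01; have mu_ := continuous_borel cu.
pose g n x := (\int[mu]_y (K n (x, y) * `|u y - u x|)%:E)%E.
have mK2 n x : measurable_fun setT (fun y => (K n (x, y))%:E).
  by apply/measurable_EFinP; apply: (measurableT_comp (mK n)); exact: measurable_pair1.
have mo2 n x : measurable_fun setT (fun y => (K n (x, y) * `|u y - u x|)%:E).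
  exact: (measurableT_comp (measurable_osc n mu_) (pair1_measurable x)).
have g0 n x : (0 <= g n x)%E.
  by apply: integral_ge0 => y _; rewrite lee_fin mulr_ge0.
have gle n x (e : R) : (forall y, K n (x, y) * `|u y - u x| <= e * K n (x, y)) ->
    0 <= e -> (g n x <= e%:E)%E.
  move=> H e0; apply: (@le_trans _ _ (\int[mu]_y (e%:E * (K n (x, y))%:E))%E).
    apply: ge0_le_integral => //.
    - by move=> y _; rewrite lee_fin mulr_ge0.
    - exact: emeasurable_funM.
    - by move=> y _; rewrite -EFinM lee_fin.
  rewrite ge0_integralZl//; last by move=> y _; rewrite lee_fin.
  by rewrite -[leRHS]mule1 lee_wpmul2l.
have mg n : measurable_fun setT (g n).
  exact: (measurable_fun_fubini_tonelli_F _ (measurable_osc n mu_)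
    (fun z => ltac:(by rewrite lee_fin mulr_ge0))).
have dom n x : (`|g n x| <= cst 1%E x)%E.
  rewrite gee0_abs//= /cst; apply: gle => // y.
  rewrite mulrC ler_wpM2r// ler_norml.
  by have := u01 x; have := u01 y; move=> /andP[? ?] /andP[? ?]; apply/andP; split; rlra.
have cvg_g : {ae mu, forall x, setT x -> g n x @[n --> \oo] --> cst 0%E x}.
  apply: negligibleS (ae_support Hd mu); apply: subsetC => x sx _.
  apply: cvge0P => // e e0.
  have [U [oU Ux] Ue] : exists2 U : set S, open_nbhs x U &
      U `<=` [set y | `|u y - u x| <= e].
    have /cvgrPdist_le/(_ e e0) := cu x; rewrite /prop_near1 nbhsE => -[U xU Ue].
    by exists U => // y /Ue /=; rewrite distrC.
  have [r r0 rU] := open_has_oball Hd oU Ux.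
  near=> n; apply: gle (ltW e0) => y.
  have [xyr|xyr] := ltP (dist x y) r.
    by rewrite mulrC ler_wpM2r//; apply: Ue; exact: rU.
  rewrite (_ : K n (x, y) = 0) ?mul0r ?mulr0//.
  by move: (y) xyr; near: n; exact: K_local.
have int1 : mu.-integrable setT (cst 1%E : borel S -> \bar R).
  by apply: finite_measure_integrable_cst.
have [_ _] := dominated_convergence measurableT mg (measurable_cst _) cvg_g int1
  (aeW _ (fun x n _ => dom n x)).
by rewrite integral0.
Unshelve. all: by end_near. Qed.

Section contraction.
Context (c : R) (c0 : 0 <= c).
Hypothesis K_comass : forall n y, (\int[mu]_x (K n (x, y))%:E <= c%:E)%E.

(** Replacing [u] by a continuous [v] costs [|u x - v x|] and the kernel average
    of [|u y - v y|]. By Tonelli the latter integrates to at most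
    [c * \int |u - v|]: the bound on the mass [\int K (x, y) dx] plays the role
    of a maximal inequality. *)
Lemma mean_oscillation_approx (u : S -> R) :
  measurable_fun setT (u : borel S -> R) -> approx_continuous u ->
  mean_oscillation (K n) u @[n --> \oo] --> 0%E.
Proof.
move=> mu_ au; have Kf0 n f z : (0 <= (K n z * `|f z : R|)%:E)%E.
  by rewrite lee_fin mulr_ge0.
apply: cvge0P => [n|e e0].
  by apply: integral_ge0 => x _; apply: integral_ge0 => y _; rewrite lee_fin mulr_ge0.
pose d := e / (c + 2).
have d0 : 0 < d by rewrite divr_gt0// ltr_wpDl.
have [v [cv v01 uv]] := au _ d0.
have mv := continuous_borel cv.
have := cvge0_near (mean_oscillation_continuous cv v01) d0.
apply: filterS => n Lv.
have muv1 : measurable_fun setT (fun x : borel S => `|u x - v x|).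
  by apply: measurableT_comp => //; exact: measurable_funB.
have muv : measurable_fun setT (fun x : borel S => (`|u x - v x|)%:E).
  exact/measurable_EFinP.
pose f1 z := (K n z * `|u z.2 - v z.2|)%:E.
pose f2 z := (K n z * `|v z.2 - v z.1|)%:E.
pose f3 z := (K n z * `|u z.1 - v z.1|)%:E.
have mf1 : measurable_fun setT f1.
  apply/measurable_EFinP; apply: measurable_funM => //.
  exact: (measurableT_comp muv1 measurable_snd).
have mf3 : measurable_fun setT f3.
  apply/measurable_EFinP; apply: measurable_funM => //.
  exact: (measurableT_comp muv1 measurable_fst).
have mf2 : measurable_fun setT f2 by exact: measurable_osc.
have mKx x : measurable_fun setT (fun y => (K n (x, y))%:E).
  by apply/measurable_EFinP; apply: (measurableT_comp (mK n)); exact: measurable_pair1.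
have mKy y : measurable_fun setT (fun x => (K n (x, y))%:E).
  by apply/measurable_EFinP; apply: (measurableT_comp (mK n)); exact: measurable_pair2.
have mx (f : borel S * borel S -> \bar R) x : measurable_fun setT f ->
    measurable_fun setT (fun y => f (x, y)).
  by move=> mf; apply: (measurableT_comp mf (pair1_measurable x)).
have f10 z : (0 <= f1 z)%E by rewrite lee_fin mulr_ge0.
have f20 z : (0 <= f2 z)%E by rewrite lee_fin mulr_ge0.
have f30 z : (0 <= f3 z)%E by rewrite lee_fin mulr_ge0.
have I1 : (\int[mu]_x \int[mu]_y f1 (x, y) <= (c * d)%:E)%E.
  rewrite (fubini_tonelli f1)//.
  apply: (@le_trans _ _ (\int[mu]_y (c%:E * (`|u y - v y|)%:E))%E).
    apply: ge0_le_integral => //.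
    - by move=> y _; apply: integral_ge0.
    - exact: (measurable_fun_fubini_tonelli_G _ mf1).
    - exact: emeasurable_funM.
    - move=> y _; rewrite /f1 /=; under eq_integral do rewrite EFinM.
      rewrite ge0_integralZr//; last by move=> x _; rewrite lee_fin.
      by rewrite lee_wpmul2r.
  rewrite ge0_integralZl ?lee_fin//.
  by rewrite [leRHS]EFinM; apply: lee_wpmul2l; rewrite ?lee_fin.
have I3 : (\int[mu]_x \int[mu]_y f3 (x, y) <= d%:E)%E.
  apply: le_trans uv; apply: ge0_le_integral => //.
  - by move=> y _; apply: integral_ge0.
  - exact: (measurable_fun_fubini_tonelli_F _ mf3).
  - move=> x _; rewrite /f3 /=; under eq_integral do rewrite EFinM.
    rewrite ge0_integralZr//; last by move=> y _; rewrite lee_fin.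
    by rewrite -[leRHS]mul1e lee_wpmul2r.
apply: (@le_trans _ _ (\int[mu]_x \int[mu]_y (f1 (x, y) + f2 (x, y) + f3 (x, y)))%E).
  have m123 : measurable_fun setT (fun z => f1 z + f2 z + f3 z)%E.
    by apply: emeasurable_funD => //; exact: emeasurable_funD.
  have p123 z : (0 <= f1 z + f2 z + f3 z)%E by rewrite !adde_ge0.
  apply: ge0_le_integral => //.
  - by move=> x _; apply: integral_ge0 => y _; rewrite lee_fin mulr_ge0.
  - exact: (measurable_fun_fubini_tonelli_F _ (measurable_osc n mu_) (Kf0 n _)).
  - exact: (measurable_fun_fubini_tonelli_F _ m123).
  - move=> x _; apply: ge0_le_integral => //.
    + by move=> y _; rewrite lee_fin mulr_ge0.
    + exact: (mx _ _ (measurable_osc n mu_)).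
    + exact: (mx _ _ m123).
    + move=> y _; rewrite /f1 /f2 /f3 /= -!EFinD lee_fin -!mulrDr ler_wpM2l//.
      rewrite (_ : u y - u x = (u y - v y) + (v y - v x) - (u x - v x)); last by ring.
      by rewrite (le_trans (ler_normB _ _))// lerD2r ler_normD.
rewrite (_ : (\int[mu]_x _)%E = (\int[mu]_x \int[mu]_y f1 (x, y) +
    \int[mu]_x \int[mu]_y f2 (x, y) + \int[mu]_x \int[mu]_y f3 (x, y))%E); last first.
  rewrite -ge0_integralD//; last 4 first.
  - by move=> x _; exact: integral_ge0.
  - exact: (measurable_fun_fubini_tonelli_F _ mf1).
  - by move=> x _; exact: integral_ge0.
  - exact: (measurable_fun_fubini_tonelli_F _ mf2).
  rewrite -ge0_integralD//; last 4 first.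
  - by move=> x _; apply: adde_ge0; exact: integral_ge0.
  - apply: emeasurable_funD; [exact: (measurable_fun_fubini_tonelli_F _ mf1)|
      exact: (measurable_fun_fubini_tonelli_F _ mf2)].
  - by move=> x _; exact: integral_ge0.
  - exact: (measurable_fun_fubini_tonelli_F _ mf3).
  apply: eq_integral => x _; rewrite !ge0_integralD//.
  - exact: mx.
  - exact: mx.
  - by move=> y _; exact: adde_ge0.
  - by apply: emeasurable_funD; exact: mx.
  - exact: mx.
apply: (@le_trans _ _ ((c * d)%:E + d%:E + d%:E)%E); first by rewrite !leeD.
rewrite -!EFinD lee_fin (_ : c * d + d + d = e) // /d.
by field; rewrite gt_eqF// ltr_wpDl.
Qed.

End contraction.
End averaging.

(** * Approximation of measurable functions by continuous ones *)

Lemma measure_setD_bigcup d (T : measurableType d) (R : realType)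
    (mu : probability T R) (F : nat -> set T) (e : R) :
  (forall n, measurable (F n)) -> nondecreasing_seq F -> 0 < e ->
  exists n, (mu ((\bigcup_n F n) `\` F n) <= e%:E)%E.
Proof.
move=> mF ndF e0; set A := \bigcup_n F n.
have mA : measurable A by exact: bigcupT_measurable.
have fA : mu A \is a fin_num by exact: fin_num_measure.
have cv : mu (F n) @[n --> \oo] --> mu A by exact: nondecreasing_cvg_mu.
have /fine_cvgP[_ /cvgrPdist_le/(_ e e0)[n _ /(_ n (leqnn n)) /= ne]] :
  mu (F n) @[n --> \oo] --> (fine (mu A))%:E by rewrite fineK.
have fF : mu (F n) \is a fin_num by exact: fin_num_measure.
exists n; rewrite (_ : mu _ = (fine (mu A) - fine (mu (F n)))%:E).
  by rewrite lee_fin; exact: le_trans (ler_norm _) ne.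
rewrite EFinB !fineK// measureD//.
  by rewrite setIidr// => x Fx; exists n.
by rewrite (le_lt_trans (probability_le1 _ _))// ltry.
Qed.

Section density_of_continuous.
Context {R : realType} {S : ptopologicalType} (dist : S -> S -> R).
Hypothesis Hd : metrizes dist.
Context (mu : probability (borel S) R).

Let mdistf (u v : S -> R) : measurable_fun setT (u : borel S -> R) ->
  measurable_fun setT (v : borel S -> R) ->
  measurable_fun setT (fun x : borel S => (`|u x - v x|)%:E).
Proof.
move=> mu_ mv; apply/measurable_EFinP; apply: measurableT_comp => //.
exact: measurable_funB.
Qed.

Lemma le_integral_dist (u v f : S -> R) : measurable_fun setT (u : borel S -> R) ->
  measurable_fun setT (v : borel S -> R) ->
  measurable_fun setT (f : borel S -> R) ->
  (forall x, `|u x - v x| <= f x) ->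
  (\int[mu]_x (`|u x - v x|)%:E <= \int[mu]_x (f x)%:E)%E.
Proof.
move=> mu_ mv mf uvf; apply: ge0_le_integral => //.
- exact: mdistf.
- exact/measurable_EFinP.
- by move=> x _; rewrite lee_fin.
Qed.

Lemma approx_continuousN (u : S -> R) :
  approx_continuous mu u -> approx_continuous mu (fun x => 1 - u x).
Proof.
move=> au e /au[v [cv v01 uv]]; exists (fun x => 1 - v x); split.
- by move=> x; apply: cvgB; [exact: cvg_cst|exact: cv].
- by move=> x; have /andP[? ?] := v01 x; apply/andP; split; rlra.
- rewrite (eq_integral (fun x : borel S => (`|u x - v x|)%:E))// => x _.
  by rewrite (_ : 1 - u x - (1 - v x) = - (u x - v x)) ?normrN//; ring.
Qed.

(** Both factors are bounded by [1], so the errors add up. *)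
Lemma approx_continuousM (u1 u2 : S -> R) :
  measurable_fun setT (u1 : borel S -> R) ->
  measurable_fun setT (u2 : borel S -> R) ->
  (forall x, 0 <= u1 x <= 1) -> (forall x, 0 <= u2 x <= 1) ->
  approx_continuous mu u1 -> approx_continuous mu u2 ->
  approx_continuous mu (fun x => u1 x * u2 x).
Proof.
move=> m1 m2 u1b u2b a1 a2 e e0; have e20 : 0 < e / 2 by rewrite divr_gt0.
have [v1 [c1 v1b uv1]] := a1 _ e20; have [v2 [c2 v2b uv2]] := a2 _ e20.
have mv1 := continuous_borel c1; have mv2 := continuous_borel c2.
exists (fun x => v1 x * v2 x); split.
- by move=> x; apply: cvgM; [exact: c1|exact: c2].
- move=> x; have /andP[? ?] := v1b x; have /andP[? ?] := v2b x.
  by rewrite mulr_ge0//= mulr_ile1.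
apply: (@le_trans _ _ (\int[mu]_x ((`|u1 x - v1 x| + `|u2 x - v2 x|)%:E))%E).
  apply: le_integral_dist.
  - exact: measurable_funM.
  - exact: measurable_funM.
  - by apply: measurable_funD; apply: measurableT_comp => //; exact: measurable_funB.
  move=> x; rewrite (_ : u1 x * u2 x - v1 x * v2 x =
    (u1 x - v1 x) * u2 x + v1 x * (u2 x - v2 x)); last by ring.
  apply: le_trans (ler_normD _ _) _; rewrite !normrM.
  have /andP[? ?] := u2b x; have /andP[? ?] := v1b x.
  by rewrite lerD// ?ler_piMr// ?ler_piMl// ger0_norm.
under eq_integral do rewrite EFinD.
rewrite ge0_integralD//; [|exact: mdistf..].
by rewrite (splitr e) EFinD leeD.
Qed.

Lemma approx_within_closed (u u' : S -> R) (e1 e2 : R) :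
  measurable_fun setT (u : borel S -> R) -> measurable_fun setT (u' : borel S -> R) ->
  (\int[mu]_x (`|u x - u' x|)%:E <= e1%:E)%E -> approx_within mu e2 u' ->
  approx_within mu (e1 + e2) u.
Proof.
move=> mu_ mu' uu' [v [cv v01 uv]]; exists v; split => //.
have mv := continuous_borel cv.
apply: (@le_trans _ _ (\int[mu]_x ((`|u x - u' x| + `|u' x - v x|)%:E))%E).
  apply: le_integral_dist => //.
    by apply: measurable_funD; apply: measurableT_comp => //; exact: measurable_funB.
  by move=> x; exact: ler_distD.
under eq_integral do rewrite EFinD.
rewrite ge0_integralD//; [|exact: mdistf..].
by rewrite EFinD leeD.
Qed.

(** These sets form a sigma-algebra that contains the balls, hence all Borel
    sets. *)
Definition approx_set : set (set (borel S)) :=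
  [set A | measurable A /\ approx_continuous mu (\1_A : borel S -> R)].

Let indic01 (A : set (borel S)) x : 0 <= (\1_A x : R) <= 1.
Proof. by rewrite indicE; case: (x \in A); rewrite /= ?lexx ?ler01. Qed.

Lemma approx_setC (A : set (borel S)) : approx_set A -> approx_set (~` A).
Proof.
move=> [mA aA]; split; first exact: measurableC.
rewrite (_ : \1_(~` A) = (fun x => 1 - \1_A x)); first exact: approx_continuousN.
by apply/funext => x; rewrite !indicE in_setC; case: (x \in A); rewrite /= ?subrr ?subr0.
Qed.

Lemma approx_setI (A B : set (borel S)) :
  approx_set A -> approx_set B -> approx_set (A `&` B).
Proof.
move=> [mA aA] [mB aB]; split; first exact: measurableI.
rewrite (_ : \1_(A `&` B) = (fun x => \1_A x * \1_B x)).
  by apply: approx_continuousM => //; exact: measurable_indic.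
by apply/funext => x; rewrite indicI.
Qed.

Lemma approx_setU (A B : set (borel S)) :
  approx_set A -> approx_set B -> approx_set (A `|` B).
Proof.
move=> aA aB; rewrite -[_ `|` _]setCK setCU; apply: approx_setC.
by apply: approx_setI; exact: approx_setC.
Qed.

Lemma integral_indic_dist (A B : set (borel S)) : measurable A -> measurable B ->
  B `<=` A -> (\int[mu]_x (`|\1_A x - \1_B x|)%:E = mu (A `\` B))%E.
Proof.
move=> mA mB BA; rewrite -[A `\` B]setIT -integral_indic//; last exact: measurableD.
apply: eq_integral => x _; congr EFin; rewrite !indicE in_setD.
have [xB|xB] := boolP (x \in B); last first.
  by rewrite subr0 ger0_norm// andbT.
by rewrite (mem_set (BA _ (set_mem xB)))/= subrr normr0.
Qed.

Lemma approx_set_bigcup (F : nat -> set (borel S)) : nondecreasing_seq F ->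
  (forall n, approx_set (F n)) -> approx_set (\bigcup_n F n).
Proof.
move=> ndF aF; have mF n : measurable (F n) by case: (aF n).
have mU : measurable (\bigcup_n F n) by exact: bigcupT_measurable.
split=> // e e0; have e20 : 0 < e / 2 by rewrite divr_gt0.
have [n ne] := measure_setD_bigcup mu mF ndF e20.
rewrite (splitr e); apply: (@approx_within_closed _ (\1_(F n))).
- exact: measurable_indic.
- exact: measurable_indic.
- by rewrite integral_indic_dist// => x Fx; exists n.
- by case: (aF n) => _; apply.
Qed.

Lemma approx_set0 : approx_set set0.
Proof.
split => // e e0; exists (fun=> 0); split.
- by move=> x; exact: cvg_cst.
- by move=> x; rewrite lexx ler01.
- rewrite integral0_eq ?lee_fin ?ltW// => x _.
  by rewrite indic0 subrr normr0.
Qed.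

Lemma approx_set_sigma_algebra : sigma_algebra setT approx_set.
Proof.
split; first exact: approx_set0.
- by move=> A aA; rewrite setTD; exact: approx_setC.
- move=> F aF; rewrite -bigcup_bigsetU_bigcup; apply: approx_set_bigcup.
    by move=> m n mn; apply/subsetPset; exact: subset_bigsetU.
  move=> n; elim: n.+1 => [|k IH]; first by rewrite big_ord0; exact: approx_set0.
  by rewrite big_ord_recr; exact: approx_setU.
Qed.

(** The function [min 1 (max 0 (n.+1 * (r - dist x0 y)))] is [1] on the closed
    ball of radius [r - rad n] and [0] outside the open ball of radius [r]. *)
Lemma approx_oball (x0 : S) (r : R) : approx_set (oball dist x0 r).
Proof.
have mo : measurable (oball dist x0 r) by exact: measurable_ball_lt.
split => // e e0; rewrite oball_bigcup//.
have [n ne] := measure_setD_bigcup mu (fun m => measurable_ball_le Hd x0 (r - rad m))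
  (cball_nondecreasing dist x0 r) e0.
pose v y := Num.min 1 (Num.max 0 (n.+1%:R * (r - dist x0 y))).
have cv : continuous v.
  have cg : continuous (fun y => n.+1%:R * (r - dist x0 y)).
    move=> y; apply: cvgM; first exact: cvg_cst.
    by apply: cvgB; [exact: cvg_cst|exact: dist_continuous].
  pose h (t : R) : R := (0 + t + `|0 - t|) / 2.
  pose k (t : R) : R := (1 + t - `|1 - t|) / 2.
  rewrite (_ : v = k \o (h \o (fun y => n.+1%:R * (r - dist x0 y)))).
    have ch : continuous h.
      move=> t; apply: cvgM; last exact: cvg_cst.
      apply: cvgD; first by apply: cvgD; [exact: cvg_cst|exact: cvg_id].
      by apply: cvg_norm; apply: cvgB; [exact: cvg_cst|exact: cvg_id].
    have ck : continuous k.
      move=> t; apply: cvgM; last exact: cvg_cst.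
      apply: cvgB; first by apply: cvgD; [exact: cvg_cst|exact: cvg_id].
      by apply: cvg_norm; apply: cvgB; [exact: cvg_cst|exact: cvg_id].
    move=> y; apply: continuous_comp; last exact: ck.
    by apply: continuous_comp; [exact: cg|exact: ch].
  by apply/funext => y; rewrite /v /k /h /= minr_absE maxr_absE.
have v01 y : 0 <= v y <= 1.
  by rewrite /v le_min ler01 le_max lexx/= ge_min lexx.
exists v; split => //; rewrite -oball_bigcup.
rewrite -oball_bigcup in ne; apply: le_trans ne.
set B := cball dist x0 (r - rad n).
have mB : measurable B by exact: measurable_ball_le.
have BA : B `<=` oball dist x0 r.
  by move=> y; rewrite /B /cball /oball /=; have := rad_gt0 R n; rlra.
apply: (@le_trans _ _
    (\int[mu]_x (`|\1_(oball dist x0 r) x - \1_B x|)%:E)%E); last first.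
  by rewrite integral_indic_dist.
apply: le_integral_dist.
- exact: measurable_indic.
- exact: continuous_borel.
- apply: measurableT_comp => //.
  by apply: measurable_funB; exact: measurable_indic.
move=> y; rewrite !indicE; have n0 : 0 < n.+1%:R :> R by [].
have [yA|yA] := boolP (y \in oball dist x0 r); last first.
  have -> : v y = 0; last by rewrite subrr normr0.
  rewrite /v (max_l _) ?(min_r _) ?ler01//.
  move: yA; rewrite notin_setE /oball/= => /negP; rewrite -leNgt => h.
  by rewrite pmulr_rle0// subr_le0.
rewrite -[true%:R]/(1 : R).
have [yB|yB] := boolP (y \in B); last first.
  rewrite subr0 normr1 ler_norml; have /andP[? ?] := v01 y.
  by apply/andP; split; rlra.
have -> : v y = 1; last by rewrite subrr normr0.
move: yB; rewrite inE /B /cball /= => h.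
rewrite /v min_l// le_max -ler_pdivrMl// mulr1; apply/orP; right.
by rewrite lerBrDr -lerBrDl; exact: h.
Qed.

(** In a separable metric space an open set is a countable union of balls. *)
Lemma approx_open (U : set S) : open U -> approx_set U.
Proof.
move=> oU; have [q qd] := dist_dense Hd.
pose V n := if unpickle n is Some nm then
  if `[< oball dist (q nm.1) (rad nm.2) `<=` U >]
  then oball dist (q nm.1) (rad nm.2) else set0 else set0.
rewrite (_ : U = \bigcup_n V n).
  have [_ _ cU] := approx_set_sigma_algebra; apply: cU => n.
  rewrite /V; case: unpickle => [nm|]; last exact: approx_set0.
  by case: ifP => _; [exact: approx_oball|exact: approx_set0].
apply/seteqP; split => x.
- move=> Ux; have [r r0 rU] := open_has_oball Hd oU Ux.
  have [m mr] : exists m, rad m < r / 2 by apply: rad_lt; rewrite divr_gt0.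
  have [n qn] := qd x (rad m) (rad_gt0 R m).
  exists (pickle (n, m)) => //; rewrite /V pickleK ifT; first exact: qn.
  apply/asboolP => y; rewrite /oball /= => qy; apply: rU => /=.
  have := dist_triangle Hd x (q n) y; rewrite (dist_sym Hd x (q n)).
  by move: qn qy mr; rlra.
- move=> [n _]; rewrite /V; case: unpickle => [nm|//].
  by case: ifP => [/asboolP|_ //]; apply.
Qed.

Lemma approx_measurable (A : set (borel S)) : measurable A -> approx_set A.
Proof.
move: A; apply: smallest_sub; first exact: approx_set_sigma_algebra.
exact: approx_open.
Qed.

(** Binary expansion of [u]: peel off [2^-1 * \1_A] with [A] the set where
    [2^-1 <= u]; what remains is [2^-1 * u'] with [u'] again between [0] and [1].
    The averaging keeps the error at [2^-n + e / 2] after [n] steps. *)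
Lemma approx_continuous_measurable (u : S -> R) :
  measurable_fun setT (u : borel S -> R) -> (forall x, 0 <= u x <= 1) ->
  approx_continuous mu u.
Proof.
move=> mu_ u01 e e0.
have e20 : 0 < e / 2 by rewrite divr_gt0.
suff H n : forall u : S -> R, measurable_fun setT (u : borel S -> R) ->
    (forall x, 0 <= u x <= 1) -> approx_within mu ((2^-1) ^+ n + e / 2) u.
  have [n ne] : exists n, (2^-1) ^+ n <= e / 2 :> R.
    have [n _ /(_ n (leqnn n)) /= ne] := near_infty_natSinv_expn_lt (PosNum e20).
    by exists n; rewrite exprVn -div1r ltW.
  have [v [cv v01 uv]] := H n u mu_ u01.
  exists v; split => //; apply: le_trans uv _.
  by rewrite lee_fin [leRHS]splitr lerD2r.
elim: n => [|n IH] {mu_ u01}u mu_ u01.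
  exists (fun=> 0); split; first by move=> x; exact: cvg_cst.
    by move=> x; rewrite lexx ler01.
  rewrite expr0; apply: (@le_trans _ _ (\int[mu]_x (1%:E))%E).
    apply: le_integral_dist => //.
    by move=> x; rewrite subr0; have /andP[? ?] := u01 x; rewrite ger0_norm.
  rewrite integral_cst// mul1e; apply: le_trans (probability_le1 mu measurableT) _.
  by rewrite lee_fin lerDl ltW.
pose A : set (borel S) := [set x | 2^-1 <= u x].
have mA : measurable A by apply: measurable_setle => //; exact: measurable_cst.
pose a x : R := \1_A (x : borel S).
have ma : measurable_fun setT (a : borel S -> R) by exact: measurable_indic.
pose u' x := 2 * u x - a x.
have mu' : measurable_fun setT (u' : borel S -> R).
  by apply: measurable_funB => //; apply: measurable_funM.
have u'01 x : 0 <= u' x <= 1.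
  rewrite /u' /a indicE; have /andP[? ?] := u01 x.
  have [|] := boolP (x \in A); rewrite ?inE ?notin_setE /A /=.
    by move=> ?; apply/andP; split; rlra.
  by move=> /negP; rewrite -ltNge => ?; apply/andP; split; rlra.
have [v' [cv' v'01 uv']] := IH u' mu' u'01.
have [_ /(_ _ e20)[w [cw w01 aw]]] := approx_measurable mA.
have mw := continuous_borel cw; have mv' := continuous_borel cv'.
exists (fun x => 2^-1 * w x + 2^-1 * v' x); split.
- by move=> x; apply: cvgD; apply: cvgM; [exact: cvg_cst|exact: cw|exact: cvg_cst|exact: cv'].
- move=> x; have /andP[? ?] := w01 x; have /andP[? ?] := v'01 x.
  by apply/andP; split; rlra.
apply: (@le_trans _ _ (\int[mu]_x
    (2^-1 * (`|a x - w x| + `|u' x - v' x|))%:E)%E).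
  apply: le_integral_dist => //.
  - by apply: measurable_funD; apply: measurable_funM.
  - apply: measurable_funM => //; apply: measurable_funD;
      apply: measurableT_comp => //; exact: measurable_funB.
  move=> x; rewrite (_ : u x - _ = 2^-1 * ((a x - w x) + (u' x - v' x))).
    by rewrite normrM ger0_norm ?invr_ge0// ler_wpM2l// ler_normD.
  by rewrite /u'; field.
under eq_integral do rewrite EFinM EFinD.
rewrite ge0_integralZl//; last 2 first.
- by apply: emeasurable_funD; exact: mdistf.
- by move=> x _; rewrite -EFinD lee_fin addr_ge0.
rewrite ge0_integralD//; [|exact: mdistf..].
apply: (@le_trans _ _ ((2^-1)%R%:E * ((e / 2)%:E + ((2^-1) ^+ n + e / 2)%:E))%E).
  by rewrite lee_wpmul2l// ?lee_fin// leeD.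
rewrite -EFinD -EFinM lee_fin exprS.
by set t := _ ^+ n; rlra.
Qed.

End density_of_continuous.

(** * Averages over balls of prescribed mass *)

Section ball_averages.
Context {R : realType} {S : ptopologicalType} (dist : S -> S -> R).
Hypothesis Hd : metrizes dist.
Context (mu : probability (borel S) R).
Implicit Types (p : R) (C : set (borel S * borel S)).

Definition mass C (x : borel S) : R := fine (mu (xsection C x)).

(** The uniform average over the section of [C] at [x], except that the
    normalization is at least [p]. This lower bound makes the open balls, whose
    mass may be much smaller than [p], as good as the closed ones. *)
Definition avg_kernel p C (z : borel S * borel S) : R :=
  \1_C z * (Num.max p (mass C z.1))^-1.

(** A substitute, in the differentiation of averages, for a covering theorem of
    Besicovitch type. *)
Definition bounded_overlap (g : R) : Prop :=
  forall p (y : S), 0 < p < 1 ->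
    (mu [set x | x <> y /\ (dist x y <= qradius dist mu p x)%R] <= (g * p)%:E)%E.

Lemma mass_ge0 C x : 0 <= mass C x. Proof. exact: fine_ge0. Qed.

Section fixed_radius.
Context (p : R) (C : set (borel S * borel S)).
Hypothesis p01 : 0 < p < 1.
Hypothesis mC : measurable C.

Let p0 : 0 < p. Proof. by case/andP: p01. Qed.
Let p1 : p < 1. Proof. by case/andP: p01. Qed.

Lemma massE x : (mass C x)%:E = mu (xsection C x).
Proof. by rewrite /mass fineK// fin_num_measure//; exact: measurable_xsection. Qed.

Lemma measurable_mass : measurable_fun setT (mass C).
Proof. by apply: measurableT_comp => //; exact: measurable_fun_xsection. Qed.

Let max_gt0 x : 0 < Num.max p (mass C x). Proof. by rewrite lt_max p0. Qed.

Lemma measurable_avg_kernel : measurable_fun setT (avg_kernel p C).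
Proof.
apply: measurable_funM; first exact: measurable_indic.
apply: (@measurable_funV_gt0 _ _ _ (fun z => Num.max p (mass C z.1))) => //.
apply: measurable_maxr; first exact: measurable_cst.
exact: (measurableT_comp measurable_mass measurable_fst).
Qed.

Lemma avg_kernel_ge0 z : 0 <= avg_kernel p C z.
Proof. by rewrite mulr_ge0// invr_ge0 ltW. Qed.

Lemma indic_xsection (x y : borel S) : \1_C (x, y) = \1_(xsection C x) y :> R.
Proof. by rewrite !indicE mem_xsection. Qed.

Lemma avg_kernel_mass x : (\int[mu]_y (avg_kernel p C (x, y))%:E <= 1)%E.
Proof.
have mX : measurable (xsection C x) by exact: measurable_xsection.
rewrite /avg_kernel /=; under eq_integral do rewrite EFinM indic_xsection.
rewrite ge0_integralZr//; last 2 first.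
- by apply/measurable_EFinP; exact: measurable_indic.
- by rewrite lee_fin invr_ge0 ltW.
rewrite integral_indic//= setIT -massE -EFinM lee_fin.
by rewrite ler_pdivrMr// mul1r le_max lexx orbT.
Qed.

Hypothesis C_sub : C `<=` [set z | dist z.1 z.2 <= qradius dist mu p z.1].

(** The centers [x] other than [y] contribute at most the overlap bound divided
    by [p]. The center [y] itself, possibly an atom of mass larger than [p],
    contributes at most [1], for [y] lies in its own ball. *)
Lemma avg_kernel_comass g (y : borel S) : bounded_overlap g ->
  (\int[mu]_x (avg_kernel p C (x, y))%:E <= (g + 1)%:E)%E.
Proof.
move=> ov.
set A : set (borel S) := [set x | x <> y /\ dist x y <= qradius dist mu p x].
have my : measurable ([set y] : set (borel S)).
  rewrite (_ : [set y] = cball dist y 0); first exact: (measurable_ball_le Hd).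
  apply/seteqP; split => [x ->|x]; first by rewrite /cball/= (dist_self Hd).
  rewrite /cball /= => yx; apply/esym/(dist_eq0 Hd)/eqP.
  by rewrite eq_le yx dist_ge0.
have mA : measurable A.
  rewrite (_ : A = ~` [set y] `&`
    [set x : borel S | dist x y <= qradius dist mu p x]) //.
  apply: measurableI; first exact: measurableC.
  apply: measurable_setle; last exact: measurable_qradius.
  by apply: (measurable_dist_comp Hd) => //; exact: measurable_cst.
pose b := \1_C (y, y) * (Num.max p (mass C y))^-1.
have b0 : 0 <= b by rewrite mulr_ge0// invr_ge0 ltW.
apply: (@le_trans _ _ (\int[mu]_x (p^-1%:E * (\1_A x)%:E + b%:E * (\1_[set y] x)%:E))%E).
  apply: ge0_le_integral => //.
  - by move=> x _; rewrite lee_fin avg_kernel_ge0.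
  - apply/measurable_EFinP.
    exact: (measurableT_comp measurable_avg_kernel (pair2_measurable y)).
  - apply: emeasurable_funD; apply: emeasurable_funM => //;
      by apply/measurable_EFinP; exact: measurable_indic.
  - move=> x _; rewrite -!EFinM -EFinD lee_fin.
    have [->|/eqP xy] := eqVneq x y.
      by rewrite [\1_[set y] y]indicE mem_set// mulr1 lerDr mulr_ge0// invr_ge0 ltW.
    rewrite [\1_[set y] x]indicE memNset// mulr0 addr0 /avg_kernel /= [leRHS]mulrC.
    apply: ler_pM => //; first by rewrite invr_ge0 ltW.
      rewrite !indicE ler_nat; have [/set_mem xyC|//] := boolP ((x, y) \in C).
      by rewrite mem_set//; split => //; exact: C_sub xyC.
    by rewrite lef_pV2 ?posrE// le_max lexx.
rewrite ge0_integralD//; last 4 first.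
- by move=> x _; rewrite -EFinM lee_fin mulr_ge0// invr_ge0 ltW.
- by apply: emeasurable_funM => //; apply/measurable_EFinP; exact: measurable_indic.
- by move=> x _; rewrite -EFinM lee_fin mulr_ge0.
- by apply: emeasurable_funM => //; apply/measurable_EFinP; exact: measurable_indic.
rewrite EFinD; apply: leeD.
- rewrite ge0_integralZl ?lee_fin ?invr_ge0 ?(ltW p0)//; last first.
    by apply/measurable_EFinP; exact: measurable_indic.
  rewrite integral_indic// setIT.
  apply: (@le_trans _ _ (p^-1%:E * (g * p)%:E)%E).
    by apply: lee_wpmul2l; rewrite ?lee_fin ?invr_ge0 ?(ltW p0)//; exact: ov.
  by rewrite -EFinM lee_fin mulrCA mulVf ?gt_eqF// mulr1.
- rewrite ge0_integralZl ?lee_fin//; last first.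
    by apply/measurable_EFinP; exact: measurable_indic.
  rewrite integral_indic// setIT /b indicE.
  have [/set_mem yC|_] := boolP ((y, y) \in C); last by rewrite mul0r mul0e lee_fin.
  apply: (@le_trans _ _ ((Num.max p (mass C y))^-1%:E * (mass C y)%:E)%E).
    rewrite mul1r; apply: lee_wpmul2l; first by rewrite lee_fin invr_ge0 ltW.
    rewrite massE; apply: le_measure; rewrite ?inE//; first exact: measurable_xsection.
    by move=> x /= ->; exact/xsectionP.
  by rewrite -EFinM lee_fin mulrC ler_pdivrMr// mul1r le_max lexx orbT.
Qed.

End fixed_radius.

Section shrinking_radius.
Context (p : nat -> R) (C : nat -> set (borel S * borel S)).
Hypothesis p01 : forall n, 0 < p n < 1.
Hypothesis p_cvg0 : p n @[n --> \oo] --> (0 : R).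
Hypothesis mC : forall n, measurable (C n).
Hypothesis C_sub : forall n,
  C n `<=` [set z | dist z.1 z.2 <= qradius dist mu (p n) z.1].

(** A ball about a point of the support has positive mass, hence contains the
    ball of mass [p n] as soon as [p n] is small enough. *)
Lemma avg_kernel_local (x : S) (r : R) : support dist mu x -> 0 < r ->
  \forall n \near \oo, forall y, r <= dist x y -> avg_kernel (p n) (C n) (x, y) = 0.
Proof.
move=> sx r0; have r20 : 0 < r / 2 by rewrite divr_gt0.
have mc : measurable (cball dist x (r / 2)) by exact: measurable_ball_le.
have fc : mu (cball dist x (r / 2)) \is a fin_num by exact: fin_num_measure.
have c0 : 0 < fine (mu (cball dist x (r / 2))).
  rewrite -lte_fin fineK//; apply: lt_le_trans (sx _ r20) _.
  apply: le_measure; rewrite ?inE//; first exact: measurable_ball_lt.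
  by move=> y /ltW.
have /cvgrPdist_le/(_ _ c0) := p_cvg0; apply: filterS => n.
rewrite sub0r normrN => pn y xyr; rewrite /avg_kernel indicE memNset ?mul0r//.
move=> /C_sub /= h; have : qradius dist mu (p n) x <= r / 2.
  apply: qradius_le; first exact: ltW.
  by rewrite -(fineK fc) lee_fin; exact: le_trans (ler_norm _) pn.
by move: xyr h; rlra.
Qed.

(** A weak form of the Lebesgue differentiation theorem: convergence in mean
    instead of almost everywhere. *)
Lemma mean_oscillation_cvg0 (u : S -> R) :
  measurable_fun setT (u : borel S -> R) -> (forall x, 0 <= u x <= 1) ->
  continuous u \/ (exists2 g, 0 <= g & bounded_overlap g) ->
  mean_oscillation mu (avg_kernel (p n) (C n)) u @[n --> \oo] --> 0%E.
Proof.
move=> mu_ u01.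
have mK n := measurable_avg_kernel (p01 n) (mC n).
have K0 n z := avg_kernel_ge0 (C n) (p01 n) z.
have K1 n x := avg_kernel_mass (p01 n) (mC n) x.
move=> [cu|[g g0 ov]].
  exact: (mean_oscillation_continuous Hd mK K0 K1 avg_kernel_local).
apply: (@mean_oscillation_approx _ _ _ Hd mu _ mK K0 K1 avg_kernel_local (g + 1)) => //.
- by rewrite addr_ge0.
- by move=> n y; exact: avg_kernel_comass.
- exact: (approx_continuous_measurable Hd).
Qed.

End shrinking_radius.
End ball_averages.

(** * Independence and iterated integrals *)

Section law.
Context {R : realType} {d d' : measure_display} {Omega : measurableType d}
  {T : measurableType d'} (P : probability Omega R).

Definition rv (X : Omega -> T) (mX : measurable_fun setT X) : {mfun Omega >-> T} :=
  mfun_Sub (mem_set mX).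

Definition law (X : Omega -> T) (mX : measurable_fun setT X) : probability T R :=
  distribution P (rv mX).

Lemma lawE (X : Omega -> T) (mX : measurable_fun setT X) (A : set T) :
  law mX A = P (X @^-1` A).
Proof. by []. Qed.

Lemma ge0_integral_law (X : Omega -> T) (mX : measurable_fun setT X)
    (f : T -> \bar R) : measurable_fun setT f -> (forall y, 0 <= f y)%E ->
  (\int[law mX]_y f y = \int[P]_w f (X w))%E.
Proof. by move=> mf f0; rewrite [LHS]ge0_integral_distribution. Qed.

End law.

Section independence.
Context {R : realType} {d d1 d2 : measure_display} {Omega : measurableType d}
  {T1 : measurableType d1} {T2 : measurableType d2} (P : probability Omega R).

Definition independent_pair (V : Omega -> T1) (W : Omega -> T2) : Prop :=
  forall A B, measurable A -> measurable B ->
    P (V @^-1` A `&` W @^-1` B) = (P (V @^-1` A) * P (W @^-1` B))%E.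

(** The law of the pair is the product of the laws; then Tonelli. *)
Lemma ge0_integral_independent (V : Omega -> T1) (W : Omega -> T2)
    (mV : measurable_fun setT V) (mW : measurable_fun setT W)
    (F : T1 * T2 -> \bar R) : independent_pair V W ->
  measurable_fun setT F -> (forall z, 0 <= F z)%E ->
  (\int[P]_w F (V w, W w) = \int[P]_w \int[law P mW]_y F (V w, y))%E.
Proof.
move=> VW mF F0; have mVW := measurable_fun_pair mV mW.
rewrite -(ge0_integral_law P mVW)//.
rewrite (eq_measure_integral (law P mV \x law P mW)%E); last first.
  by move=> A mA _; apply/esym/product_measure_unique.
rewrite (fubini_tonelli1 F)// /fubini_F.
rewrite (ge0_integral_law P mV (f := fun x => \int[law P mW]_y F (x, y))%E)//.
- exact: (measurable_fun_fubini_tonelli_F _ mF).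
- by move=> x; apply: integral_ge0 => y _.
Qed.

End independence.

Section independence3.
Context {R : realType} {d d1 d2 d3 : measure_display} {Omega : measurableType d}
  {T1 : measurableType d1} {T2 : measurableType d2} {T3 : measurableType d3}
  (P : probability Omega R).

(** Measurable sets of pairs are generated by rectangles, on which both sides
    agree as finite measures. *)
Lemma independent_triple (V : Omega -> T1) (W : Omega -> T2) (Z : Omega -> T3) :
  measurable_fun setT V -> measurable_fun setT W -> measurable_fun setT Z ->
  (forall A B C, measurable A -> measurable B -> measurable C ->
    P (V @^-1` A `&` W @^-1` B `&` Z @^-1` C) =
    (P (V @^-1` A) * P (W @^-1` B) * P (Z @^-1` C))%E) ->
  independent_pair P (fun w => (V w, W w)) Z.
Proof.
move=> mV mW mZ VWZ A C mA mC.
have PVW B1 B2 : measurable B1 -> measurable B2 ->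
    P (V @^-1` B1 `&` W @^-1` B2) = (P (V @^-1` B1) * P (W @^-1` B2))%E.
  move=> mB1 mB2; have := VWZ B1 B2 setT mB1 mB2 measurableT.
  by rewrite preimage_setT setIT probability_setT mule1.
have mVW := measurable_fun_pair mV mW.
have mZC : measurable (Z @^-1` C) by rewrite -[X in measurable X]setTI; exact: mZ.
pose VW w := (V w, W w).
pose m1 : {measure set (T1 * T2) -> \bar R} := pushforward (mrestr P mZC) VW.
have c0 : 0 <= fine (P (Z @^-1` C)) by exact: fine_ge0.
pose m2 : {measure set (T1 * T2) -> \bar R} := mscale (NngNum c0) (law P mVW).
have m2E B : m2 B = (P ((fun w => (V w, W w)) @^-1` B) * P (Z @^-1` C))%E.
  have fC : P (Z @^-1` C) \is a fin_num by exact: fin_num_measure.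
  by rewrite [RHS]muleC -[in RHS](fineK fC).
rewrite -m2E -[LHS]/(m1 mVW A).
pose G : set (set (T1 * T2)) :=
  [set E | exists A B, [/\ measurable A, measurable B & E = A `*` B]].
apply: (measure_unique G (fun=> setT)) => //.
- rewrite measurable_prod_measurableType; congr (<<s _ >>).
  apply/seteqP; split => [_ [B1 mB1 [B2 mB2 <-]]|_ [B1 [B2 [mB1 mB2 ->]]]].
    by exists B1, B2.
  by exists B1 => //; exists B2.
- move=> _ _ [A1 [A2 [mA1 mA2 ->]]] [B1 [B2 [mB1 mB2 ->]]].
  by exists (A1 `&` B1), (A2 `&` B2); rewrite -setXI; split => //; exact: measurableI.
- by move=> _; exists setT, setT; split => //; rewrite setXTT.
- by rewrite bigcup_const//; exists 0%N.
- move=> _ [B1 [B2 [mB1 mB2 ->]]]; rewrite m2E -[LHS]/(P (_ `&` _)).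
  rewrite -[X in P (X `&` _)]/(V @^-1` B1 `&` W @^-1` B2) VWZ//.
  by congr (_ * _)%E; rewrite -PVW.
- move=> _; rewrite -[X in (X < _)%E]/(P (_ `&` _)).
  rewrite (le_lt_trans (probability_le1 _ _)) ?ltry//.
  by apply: measurableI => //; rewrite preimage_setT.
Qed.

End independence3.

(** * Concentration of the number of hits *)

Section bounded_expectation.
Context {R : realType} {d : measure_display} {Omega : measurableType d}.

Definition bounded_mfun (f : Omega -> R) : Prop :=
  measurable_fun setT f /\ exists M : R, forall w, `|f w| <= M.

Lemma bounded_mfun_cst (c : R) : bounded_mfun (fun=> c).
Proof. by split => //; exists `|c|. Qed.

Lemma bounded_mfunD f g : bounded_mfun f -> bounded_mfun g ->
  bounded_mfun (fun w => f w + g w).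
Proof.
move=> [mf [M fM]] [mg [N gN]]; split; first exact: measurable_funD.
by exists (M + N) => w; apply: le_trans (ler_normD _ _) _; rewrite lerD.
Qed.

Lemma bounded_mfunM f g : bounded_mfun f -> bounded_mfun g ->
  bounded_mfun (fun w => f w * g w).
Proof.
move=> [mf [M fM]] [mg [N gN]]; split; first exact: measurable_funM.
by exists (M * N) => w; rewrite normrM ler_pM.
Qed.

Lemma bounded_mfunB f g : bounded_mfun f -> bounded_mfun g ->
  bounded_mfun (fun w => f w - g w).
Proof.
move=> bf bg; have -> : (fun w => f w - g w) = (fun w => f w + (-1) * g w).
  by apply/funext => w; rewrite mulN1r.
by apply: bounded_mfunD => //; apply: bounded_mfunM => //; exact: bounded_mfun_cst.
Qed.

Lemma bounded_mfun_sum (I : Type) (r : seq I) (A : pred I) (f : I -> Omega -> R) :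
  (forall i, bounded_mfun (f i)) -> bounded_mfun (fun w => \sum_(i <- r | A i) f i w).
Proof.
move=> bf; elim: r => [|i r IH].
  by under eq_fun do rewrite big_nil; exact: bounded_mfun_cst.
under eq_fun do rewrite big_cons.
by case: (A i) => //; exact: bounded_mfunD.
Qed.

Context (P : probability Omega R).

Lemma bounded_mfun_integrable f : bounded_mfun f -> P.-integrable setT (EFin \o f).
Proof.
move=> [mf [M fM]]; apply: measurable_bounded_integrable => //.
  by rewrite (le_lt_trans (probability_le1 _ _)) ?ltry.
exists M; split; first exact: num_real.
by move=> x Mx y _ /=; exact: le_trans (fM y) (ltW Mx).
Qed.

Lemma Rintegral_sum (I : Type) (r : seq I) (A : pred I) (f : I -> Omega -> R) :
  (forall i, bounded_mfun (f i)) ->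
  (\int[P]_w (\sum_(i <- r | A i) f i w) = \sum_(i <- r | A i) \int[P]_w f i w)%R.
Proof.
move=> bf; elim: r => [|i r IH].
  rewrite big_nil -[RHS](mul0r (fine (P setT))) -Rintegral_cst//.
  by apply: eq_Rintegral => w _; rewrite big_nil.
rewrite big_cons -IH; case Ai: (A i); last first.
  by apply: eq_Rintegral => w _; rewrite big_cons Ai.
rewrite -RintegralD//; last 2 first.
- exact: bounded_mfun_integrable.
- by apply: bounded_mfun_integrable; exact: bounded_mfun_sum.
by apply: eq_Rintegral => w _; rewrite big_cons Ai.
Qed.

Lemma EFin_Rintegral f : bounded_mfun f ->
  (\int[P]_w f w)%R%:E = (\int[P]_w (f w)%:E)%E.
Proof.
by move=> /bounded_mfun_integrable bf; rewrite fineK//; exact: integrable_fin_num.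
Qed.

End bounded_expectation.

Section concentration.
Context {R : realType} {d d' : measure_display} {Omega : measurableType d}
  {T : measurableType d'} (P : probability Omega R).
Context (X : Omega -> T) (mX : measurable_fun setT X).
Context (n : nat) (xs : 'I_n -> Omega -> T).
Hypothesis mxs : forall i, measurable_fun setT (xs i).
Hypothesis indep : forall (A : 'I_n -> set T) (B : set T),
  (forall i, measurable (A i)) -> measurable B ->
  P ((\bigcap_i (xs i @^-1` A i)) `&` X @^-1` B) =
  ((\prod_(i < n) P (xs i @^-1` A i)) * P (X @^-1` B))%E.
Context (C : set (T * T)) (mC : measurable C).

Definition hit_prob (i : 'I_n) (x : T) : R := fine (P (xs i @^-1` xsection C x)).

(** The section of [C] at [X] is a set that is random through [X] only, not
    through the sample. *)
Definition hits (I : pred 'I_n) (w : Omega) : R :=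
  \sum_(i < n | I i) \1_C (X w, xs i w).

(** The conditional expectation of [hits] given the value of [X]. *)
Definition mean_hits (I : pred 'I_n) (x : T) : R := \sum_(i < n | I i) hit_prob i x.

Lemma hit_probE i x : (hit_prob i x)%:E = law P (mxs i) (xsection C x).
Proof.
rewrite /hit_prob -(lawE P (mxs i)) fineK// fin_num_measure//.
exact: measurable_xsection.
Qed.

Lemma hit_prob01 i x : 0 <= hit_prob i x <= 1.
Proof.
rewrite -!lee_fin hit_probE measure_ge0/=.
by apply: probability_le1; exact: measurable_xsection.
Qed.

Lemma measurable_hit_prob i : measurable_fun setT (hit_prob i).
Proof.
rewrite (_ : hit_prob i = fine \o (law P (mxs i) \o xsection C)) //.
by apply: measurableT_comp => //; exact: measurable_fun_xsection.
Qed.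

Lemma independent_hit (i j : 'I_n) : i != j ->
  independent_pair P (fun w => (X w, xs i w)) (xs j).
Proof.
move=> ij; apply: independent_triple => // A B D mA mB mD.
pose E k := if k == i then B else if k == j then D else [set: T].
have mE k : measurable (E k) by rewrite /E; case: ifP => _ //; case: ifP.
have := indep mE mA.
rewrite (_ : \bigcap_i _ = xs i @^-1` B `&` xs j @^-1` D); last first.
  apply/seteqP; split => w /=.
    move=> h; split; first by have := h i I; rewrite /E eqxx.
    by have := h j I; rewrite /E eq_sym (negbTE ij) eqxx.
  by move=> [wB wD] k _; rewrite /E /=; case: eqP => [->//|_]; case: eqP => [->|].
rewrite (bigD1 i)//= (bigD1 j)/=; last by rewrite eq_sym.
rewrite big1 ?mule1; last first.
  move=> k /andP[/negbTE ki /negbTE kj].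
  by rewrite /E ki kj preimage_setT probability_setT.
rewrite /E eqxx eq_sym (negbTE ij) eqxx => h.
rewrite [X in P X](_ : _ = xs i @^-1` B `&` xs j @^-1` D `&` X @^-1` A).
  by rewrite h muleC muleA.
by rewrite [RHS]setIC setIA.
Qed.

Lemma independent_single (j : 'I_n) : independent_pair P X (xs j).
Proof.
move=> A D mA mD; pose E k := if k == j then D else [set: T].
have mE k : measurable (E k) by rewrite /E; case: ifP.
have := indep mE mA.
rewrite (_ : \bigcap_i _ = xs j @^-1` D); last first.
  apply/seteqP; split => w /=.
    by move=> h; have := h j I; rewrite /E eqxx.
  by move=> wD k _; rewrite /E /=; case: eqP => [->|].
rewrite (bigD1 j)//= big1 ?mule1; last first.
  by move=> k /negbTE kj; rewrite /E kj preimage_setT probability_setT.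
by rewrite /E eqxx setIC muleC.
Qed.

Lemma measurable_indic_comp d0 (U : measurableType d0) (h : U -> T * T) :
  measurable_fun setT h -> measurable_fun setT (fun u => \1_C (h u) : R).
Proof.
have mI : measurable_fun setT (\1_C : T * T -> R) by exact: measurable_indic.
by move=> mh; exact: (measurableT_comp mI mh).
Qed.

Lemma measurable_hit (i : 'I_n) :
  measurable_fun setT (fun w => \1_C (X w, xs i w) : R).
Proof.
by apply: measurable_indic_comp; exact: measurable_fun_pair.
Qed.

Lemma bounded_hit (i : 'I_n) : bounded_mfun (fun w => \1_C (X w, xs i w) : R).
Proof.
split; first exact: measurable_hit.
by exists 1 => w; rewrite indicE; case: (_ \in _); rewrite ?normr0 ?normr1.
Qed.

Lemma bounded_hit_prob (i : 'I_n) : bounded_mfun (fun w => hit_prob i (X w)).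
Proof.
split; first by apply: measurableT_comp => //; exact: measurable_hit_prob.
by exists 1 => w; have /andP[? ?] := hit_prob01 i (X w); rewrite ger0_norm.
Qed.

(** Given [V], which determines [X], the hit indicator of an independent sample
    point has expectation [hit_prob j (X w)]. *)
Lemma expectation_centered d1 (T1 : measurableType d1) (V : Omega -> T1)
    (mV : measurable_fun setT V) (g : T1 -> T) (mg : measurable_fun setT g)
    (j : 'I_n) (H : T1 -> R) :
  independent_pair P V (xs j) -> (forall w, X w = g (V w)) ->
  bounded_mfun H ->
  (\int[P]_w (H (V w) * (\1_C (X w, xs j w) - hit_prob j (X w))) = 0)%R.
Proof.
move=> Vj gX.
(* Tonelli needs a nonnegative weight; the general case follows by adding a
   constant to [H]. *)
have main (H0 : T1 -> R) : bounded_mfun H0 -> (forall v, 0 <= H0 v) ->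
    (\int[P]_w (H0 (V w) * (\1_C (X w, xs j w) - hit_prob j (X w))) = 0)%R.
  move=> [mH [M HM]] H0_ge0.
  have bH : bounded_mfun (fun w => H0 (V w)).
    by split; [exact: measurableT_comp|exists M => w].
  under eq_Rintegral do rewrite mulrBr.
  rewrite RintegralB//; last 2 first.
  - by apply: bounded_mfun_integrable; apply: bounded_mfunM => //; exact: bounded_hit.
  - by apply: bounded_mfun_integrable; apply: bounded_mfunM => //; exact: bounded_hit_prob.
  apply/eqP; rewrite subr_eq0; apply/eqP; congr fine.
  pose F (z : T1 * T) : \bar R := (H0 z.1 * \1_C (g z.1, z.2))%:E.
  have mF : measurable_fun setT F.
    apply/measurable_EFinP; apply: measurable_funM.
      exact: (measurableT_comp mH measurable_fst).
    apply: measurable_indic_comp; apply: measurable_fun_pair; last exact: measurable_snd.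
    exact: (measurableT_comp mg measurable_fst).
  have F0 z : (0 <= F z)%E by rewrite lee_fin mulr_ge0.
  have := ge0_integral_independent mV (mxs j) Vj mF F0.
  rewrite /F /=; under eq_integral do rewrite -gX.
  move=> ->; apply: eq_integral => w _.
  under eq_integral do rewrite EFinM -gX.
  rewrite ge0_integralZl ?lee_fin//; last first.
    by apply/measurable_EFinP; apply: measurable_indic_comp; exact: pair1_measurable.
  rewrite EFinM hit_probE; congr (_ * _)%E.
  rewrite -[xsection _ _]setIT -integral_indic//; last exact: measurable_xsection.
  by apply: eq_integral => y _; rewrite !indicE mem_xsection.
move=> [mH [M HM]].
have MH v : 0 <= H v + M.
  by have := HM v; rewrite ler_norml => /andP[? _]; rlra.
have M0 v : 0 <= M := le_trans (normr_ge0 _) (HM v).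
have bHM : bounded_mfun (fun v => H v + M).
  by apply: bounded_mfunD; [split => //; exists M|exact: bounded_mfun_cst].
have bHMV : bounded_mfun (fun w => H (V w) + M).
  case: bHM => mHM [N HN]; split; last by exists N => w.
  exact: (measurableT_comp mHM mV).
have bZ : bounded_mfun (fun w => \1_C (X w, xs j w) - hit_prob j (X w)).
  by apply: bounded_mfunB; [exact: bounded_hit|exact: bounded_hit_prob].
have := main (fun v => H v + M) bHM MH.
have := main (fun=> M) (bounded_mfun_cst _) M0.
move=> h1 h2.
have <- : (\int[P]_w ((H (V w) + M) * (\1_C (X w, xs j w) - hit_prob j (X w))) -
    \int[P]_w (M * (\1_C (X w, xs j w) - hit_prob j (X w))) = 0 :> R)%R.
  by rewrite h1 h2 subr0.
rewrite -RintegralB//; last 2 first.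
- by apply: bounded_mfun_integrable; exact: bounded_mfunM.
- by apply: bounded_mfun_integrable; apply: bounded_mfunM => //; exact: bounded_mfun_cst.
by apply: eq_Rintegral => w _; ring.
Qed.

Context (kappa : R) (kappa0 : 0 < kappa).

(** The deviation of a count is compared with the larger of [kappa] and of the
    expected count: its variance is at most the expected count. *)
Definition scale (x : T) : R := Num.max kappa (mean_hits xpredT x).

Lemma scale_gt0 x : 0 < scale x.
Proof. by rewrite /scale lt_max kappa0. Qed.

Lemma measurable_mean_hits I : measurable_fun setT (mean_hits I).
Proof.
rewrite /mean_hits; under eq_fun do rewrite big_mkcond.
apply: measurable_sum => i; case: (I i); last exact: measurable_cst.
exact: measurable_hit_prob.
Qed.

Lemma measurable_hits I : measurable_fun setT (hits I).
Proof.
rewrite /hits; under eq_fun do rewrite big_mkcond.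
apply: measurable_sum => i; case: (I i); last exact: measurable_cst.
exact: measurable_hit.
Qed.

Lemma measurable_scale : measurable_fun setT scale.
Proof.
apply: measurable_maxr; first exact: measurable_cst.
exact: measurable_mean_hits.
Qed.

Let G (x : T) : R := (scale x)^-1 ^+ 2.

Let G_ge0 x : 0 <= G x. Proof. by rewrite exprn_ge0// invr_ge0 ltW// scale_gt0. Qed.

Let bounded_G : bounded_mfun G.
Proof.
split.
  apply: measurable_funX; apply: measurable_funV_gt0; first exact: scale_gt0.
  exact: measurable_scale.
exists (kappa^-1 ^+ 2) => x; rewrite ger0_norm//.
rewrite lerXn2r ?nnegrE ?invr_ge0 ?(ltW (scale_gt0 _)) ?(ltW kappa0)//.
by rewrite lef_pV2 ?posrE ?scale_gt0// /scale le_max lexx.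
Qed.

Let U (i : 'I_n) (w : Omega) : R := \1_C (X w, xs i w) - hit_prob i (X w).

Let bounded_U i : bounded_mfun (U i).
Proof. by apply: bounded_mfunB; [exact: bounded_hit|exact: bounded_hit_prob]. Qed.

Let bounded_comp_X (H : T -> R) : bounded_mfun H -> bounded_mfun (fun w => H (X w)).
Proof.
move=> [mH [M HM]]; split; last by exists M => w.
exact: measurableT_comp.
Qed.

Lemma covariance_offdiag i j : i != j ->
  (\int[P]_w (G (X w) * U i w * U j w) = 0)%R.
Proof.
move=> ij; pose H (z : T * T) : R := G z.1 * (\1_C z - hit_prob i z.1).
have bG1 : bounded_mfun (fun z : T * T => G z.1).
  case: bounded_G => mG [M GM]; split; last by exists M => z.
  exact: (measurableT_comp mG measurable_fst).
have bH : bounded_mfun H.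
  apply: bounded_mfunM => //; apply: bounded_mfunB.
    split; first exact: measurable_indic.
    by exists 1 => z; rewrite indicE; case: (_ \in _); rewrite ?normr0 ?normr1.
  split; first exact: (measurableT_comp (measurable_hit_prob i) measurable_fst).
  by exists 1 => z; have /andP[? ?] := hit_prob01 i z.1; rewrite ger0_norm.
exact: (expectation_centered (measurable_fun_pair mX (mxs i)) measurable_fst
  (independent_hit ij) (fun=> erefl) bH).
Qed.

(** A Bernoulli variable of parameter [q] has variance [q - q ^ 2 <= q]. *)
Lemma variance_diag i :
  (\int[P]_w (G (X w) * U i w * U i w) <= \int[P]_w (G (X w) * hit_prob i (X w)))%R.
Proof.
pose H (x : T) : R := G x * (1 - 2 * hit_prob i x).
have bq : bounded_mfun (hit_prob i).
  split; first exact: measurable_hit_prob.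
  by exists 1 => x; have /andP[? ?] := hit_prob01 i x; rewrite ger0_norm.
have bH : bounded_mfun H.
  apply: bounded_mfunM => //; apply: bounded_mfunB; first exact: bounded_mfun_cst.
  by apply: bounded_mfunM => //; exact: bounded_mfun_cst.
have bGq2 : bounded_mfun (fun x => G x * (hit_prob i x - hit_prob i x * hit_prob i x)).
  by apply: bounded_mfunM => //; apply: bounded_mfunB => //; exact: bounded_mfunM.
have bGq : bounded_mfun (fun x => G x * hit_prob i x) by exact: bounded_mfunM.
have E := expectation_centered mX (g := id) (@measurable_id _ _ setT)
  (independent_single i) (fun=> erefl) bH.
rewrite (_ : (\int[P]_w _)%R = (\int[P]_w (H (X w) * U i w) + \int[P]_w (G (X w) *
  (hit_prob i (X w) - hit_prob i (X w) * hit_prob i (X w))))%R); last first.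
  rewrite -RintegralD//; last 2 first.
  - by apply: bounded_mfun_integrable; apply: bounded_mfunM => //; exact: bounded_comp_X.
  - by apply: bounded_mfun_integrable; exact: (bounded_comp_X bGq2).
  apply: eq_Rintegral => w _; rewrite /H /U indicE.
  by case: (_ \in _) => /=; ring.
rewrite E add0r; apply: le_Rintegral => //.
- by apply: bounded_mfun_integrable; exact: (bounded_comp_X bGq2).
- by apply: bounded_mfun_integrable; exact: (bounded_comp_X bGq).
- move=> w _; rewrite ler_wpM2l// lerBlDr lerDl.
  by have /andP[? ?] := hit_prob01 i (X w); rewrite mulr_ge0.
Qed.

Lemma measurable_deviation (I : pred 'I_n) (delta : R) : measurable
  [set w | delta * scale (X w) <= `|hits I w - mean_hits I (X w)|].
Proof.
apply: measurable_setle.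
  by apply: measurable_funM => //; apply: measurableT_comp => //; exact: measurable_scale.
apply: measurableT_comp => //; apply: measurable_funB; first exact: measurable_hits.
by apply: measurableT_comp => //; exact: measurable_mean_hits.
Qed.

(** Chebyshev inequality for the deviation divided by [scale]. Dividing before
    integrating over [X] gives a bound free of the law of [X]: the normalized
    variance is at most [mean_hits / scale ^ 2 <= kappa^-1]. *)
Lemma hits_concentration (I : pred 'I_n) (delta : R) : 0 < delta ->
  (P [set w | (delta * scale (X w) <= `|hits I w - mean_hits I (X w)|)%R]
    <= ((delta ^+ 2 * kappa)^-1)%:E)%E.
Proof.
move=> delta0.
pose V w := \sum_(i < n | I i) \sum_(j < n | I j) G (X w) * U i w * U j w.
have VE w : V w = G (X w) * (hits I w - mean_hits I (X w)) ^+ 2.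
  rewrite /hits /mean_hits -sumrB expr2 mulrA [G (X w) * _]mulr_sumr mulr_suml /V.
  by apply: eq_bigr => i _; rewrite mulr_sumr.
have bt i j : bounded_mfun (fun w => G (X w) * U i w * U j w).
  apply: bounded_mfunM => //; apply: bounded_mfunM => //.
  exact: (bounded_comp_X bounded_G).
have bV : bounded_mfun V.
  by apply: bounded_mfun_sum => i; apply: bounded_mfun_sum => j.
have bGq i : bounded_mfun (fun w => G (X w) * hit_prob i (X w)).
  by apply: bounded_mfunM; [exact: (bounded_comp_X bounded_G)|exact: bounded_hit_prob].
have EV : (\int[P]_w V w <= kappa^-1)%R.
  rewrite Rintegral_sum; last by move=> i; exact: bounded_mfun_sum.
  apply: (@le_trans _ _ (\sum_(i < n) \int[P]_w (G (X w) * hit_prob i (X w)))%R).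
    rewrite big_mkcond; apply: ler_sum => i _; case: ifP => Ii; last first.
      apply: Rintegral_ge0 => w _; rewrite mulr_ge0//.
      by have /andP[] := hit_prob01 i (X w).
    rewrite Rintegral_sum// (bigD1 i)//= big1 ?addr0; first exact: variance_diag.
    by move=> j /andP[_ ji]; apply: covariance_offdiag; rewrite eq_sym.
  rewrite -Rintegral_sum//.
  apply: (@le_trans _ _ (\int[P]_w (fun=> kappa^-1) w)%R).
    apply: le_Rintegral => //.
    - by apply: bounded_mfun_integrable; exact: bounded_mfun_sum.
    - by apply: bounded_mfun_integrable; exact: bounded_mfun_cst.
    move=> w _; rewrite -mulr_sumr -/(mean_hits xpredT (X w)).
    have s0 := scale_gt0 (X w).
    have ms : mean_hits xpredT (X w) <= scale (X w) by rewrite /scale le_max lexx orbT.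
    have ks : kappa <= scale (X w) by rewrite /scale le_max lexx.
    apply: (@le_trans _ _ (scale (X w))^-1); last by rewrite lef_pV2.
    by rewrite /G expr2 -mulrA ler_piMr ?invr_ge0 ?(ltW s0)// ler_pdivrMl// mulr1.
  rewrite Rintegral_cst// ler_piMr// ?invr_ge0 ?(ltW kappa0)//.
  by rewrite -lee_fin fineK ?probability_le1// fin_num_measure.
set E := [set w | _].
have mE : measurable E by exact: measurable_deviation.
apply: (@le_trans _ _ ((\int[P]_w ((delta ^+ 2)^-1 * V w))%R)%:E).
  rewrite EFin_Rintegral; last by apply: bounded_mfunM => //; exact: bounded_mfun_cst.
  rewrite -[E]setIT -integral_indic//; apply: ge0_le_integral => //.
  - by apply/measurable_EFinP; exact: measurable_indic.
  - by apply/measurable_EFinP; apply: measurable_funM => //; case: bV.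
  move=> w _; rewrite lee_fin VE indicE.
  have [/set_mem Ew|_] := boolP (w \in E); last first.
    by rewrite mulr_ge0// ?invr_ge0 ?exprn_ge0 ?(ltW delta0)// mulr_ge0// sqr_ge0.
  rewrite ler_pdivlMl ?exprn_gt0// mulr1 /G -exprMn -[leRHS]real_normK ?num_real//.
  rewrite lerXn2r ?nnegrE ?(ltW delta0)// normrM ger0_norm ?invr_ge0 ?(ltW (scale_gt0 _))//.
  by rewrite ler_pdivlMl ?scale_gt0// mulrC.
rewrite lee_fin RintegralZl//; last exact: bounded_mfun_integrable.
by rewrite [leRHS]invfM ler_wpM2l// invr_ge0 exprn_ge0// ltW.
Qed.

End concentration.

(** * The nearest neighbor radius *)

Section knn.
Context {R : realType} {S : ptopologicalType} (dist : S -> S -> R).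
Hypothesis Hd : metrizes dist.
Context (n : nat) (xs : 'I_n -> S) (k : nat) (x : S).
Hypothesis k0n : (0 < k <= n)%N.

Let k0 : (0 < k)%N. Proof. by case/andP: k0n. Qed.
Let kn : (k <= n)%N. Proof. by case/andP: k0n. Qed.

Definition nb_within (r : R) : nat := #|[pred i : 'I_n | dist x (xs i) <= r]|.

Lemma knn_radius_le (r : R) : 0 <= r -> (k <= nb_within r)%N ->
  knn_radius dist xs k x <= r.
Proof. by move=> r0 kr; apply: ge_inf => //; exists 0 => s []. Qed.

Lemma knn_set_nonempty : [set r : R | 0 <= r /\ (k <= nb_within r)%N] !=set0.
Proof.
have d0 i : 0 <= dist x (xs i) by exact: dist_ge0.
exists (\sum_(i < n) dist x (xs i)); split; first exact: sumr_ge0.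
rewrite /nb_within (leq_trans kn)// -[leqLHS]card_ord.
apply/subset_leq_card/fintype.subsetP => i _; rewrite !inE.
by rewrite (bigD1 i)//= lerDl sumr_ge0.
Qed.

(** Finitely many values leave a gap above [r]; this is why the infimum defining
    the nearest neighbor radius is attained. *)
Lemma gap_above (r : R) (s : seq R) :
  exists2 e : R, 0 < e & forall t, t \in s -> r < t -> r + e < t.
Proof.
elim: s => [|a s [e e0 H]]; first by exists 1.
have [ra|ar] := ltP r a; last first.
  exists e => // t; rewrite inE => /predU1P[->|]; last exact: H.
  by rewrite ltNge ar.
exists (Num.min e ((a - r) / 2)).
  by rewrite lt_min e0 divr_gt0// subr_gt0.
move=> t; rewrite inE => /predU1P[-> _|ts rt].
  apply: (@le_lt_trans _ _ (r + (a - r) / 2)); first by rewrite lerD2l ge_min lexx orbT.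
  by move: ra; rlra.
by apply: le_lt_trans (H t ts rt); rewrite lerD2l ge_min lexx.
Qed.

Lemma knn_count : (k <= nb_within (knn_radius dist xs k x))%N.
Proof.
set r0 := knn_radius _ _ _ _.
have [e e0 H] := gap_above r0 [seq dist x (xs i) | i : 'I_n].
have [r [r_ge0 kr] rr] : exists2 r : R, 0 <= r /\ (k <= nb_within r)%N & r < r0 + e.
  apply: inf_adherent => //; split; first exact: knn_set_nonempty.
  by exists 0 => s [].
apply: leq_trans kr _; apply/subset_leq_card/fintype.subsetP => i; rewrite !inE => ir.
rewrite leNgt; apply/negP => /(H _ (ltac:(by apply: map_f; rewrite mem_enum))).
by move: ir rr; rlra.
Qed.

(** A description of the neighbors of [x] without the radius, from which their
    measurability is read off. *)
Lemma within_knn_radius (i : 'I_n) :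
  (dist x (xs i) <= knn_radius dist xs k x) =
  (#|[pred j : 'I_n | (dist x (xs j) < dist x (xs i))%R]| < k)%N.
Proof.
apply/idP/idP => [ir|].
  rewrite ltnNge; apply/negP => ki.
  have [j0 j0i] : exists j, dist x (xs j) < dist x (xs i).
    by have /card_gt0P[j] := leq_trans k0 ki; rewrite inE; exists j.
  have [j ji jmax] := @arg_maxP _ _ _ j0 [pred j : 'I_n | dist x (xs j) < dist x (xs i)]
    (fun j => dist x (xs j)) j0i.
  have := @knn_radius_le (dist x (xs j)) (dist_ge0 Hd _ _) (ltac:(
    apply: leq_trans ki _; apply/subset_leq_card/fintype.subsetP => l; exact: jmax)).
  by move=> rj; have := le_trans ir rj; rewrite leNgt; move/negP; apply.
move=> ki; rewrite leNgt; apply/negP => ri; move: ki; rewrite ltnNge => /negP; apply.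
apply: leq_trans knn_count _; apply/subset_leq_card/fintype.subsetP => j; rewrite !inE.
by move=> /le_lt_trans; apply.
Qed.

End knn.

Lemma card_natrE (R : pzSemiRingType) (I : finType) (A : pred I) :
  #|A|%:R = \sum_(i : I) (A i)%:R :> R.
Proof.
rewrite -sum1_card natr_sum big_mkcond; apply: eq_bigr => i _.
by rewrite unfold_in; case: (A i).
Qed.

Section measurable_knn.
Context {R : realType} {S : ptopologicalType} (dist : S -> S -> R).
Hypothesis Hd : metrizes dist.
Context (d : measure_display) (Omega : measurableType d).
Context (X : Omega -> borel S) (mX : measurable_fun setT X).
Context (n : nat) (xs : 'I_n -> Omega -> borel S).
Hypothesis mxs : forall i, measurable_fun setT (xs i).
Context (k : nat) (k0n : (0 < k <= n)%N).

Lemma measurable_card (b : 'I_n -> Omega -> bool) :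
  (forall i, measurable_fun setT (b i)) ->
  measurable_fun setT (fun w => #|[pred i | b i w]|%:R : R).
Proof.
move=> mb; under eq_fun do rewrite card_natrE.
apply: measurable_sum => i /=.
rewrite (_ : (fun w => _) = (\1_(b i @^-1` [set true]) : Omega -> R)).
  apply: measurable_indic; rewrite -[X in measurable X]setTI.
  exact: mb.
apply/funext => w; rewrite indicE; congr (_%:R); congr nat_of_bool.
by apply/idP/idP => [bw|/set_mem//]; rewrite inE.
Qed.

Lemma measurable_within (i : 'I_n) : measurable_fun setT
  (fun w => dist (xs i w) (X w) <= knn_radius dist (fun j => xs j w) k (X w)).
Proof.
rewrite (_ : (fun w => _) = (fun w => (#|[pred j : 'I_n |
    dist (X w) (xs j w) < dist (X w) (xs i w)]|%:R < k%:R :> R))).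
  apply: measurable_fun_ltr; last exact: measurable_cst.
  apply: measurable_card => j; apply: measurable_fun_ltr;
    exact: (measurable_dist_comp Hd).
apply/funext => w; rewrite ltr_nat (dist_sym Hd).
exact: (within_knn_radius Hd (fun j => xs j w) (X w) k0n).
Qed.

Lemma measurable_knn_statistic (L : nat) (lab : 'I_n -> 'I_L) (theta : 'I_L) :
  measurable_fun setT
    (fun w => knn_statistic dist (fun i => xs i w) lab k theta (X w)).
Proof.
apply: measurable_funN; apply: measurable_funM.
  apply: measurable_card => i; apply: measurable_and => //.
  exact: measurable_within.
apply: measurable_funV_gt0 => [w|].
  rewrite ltr0n; have /andP[k0 _] := k0n; apply: leq_trans k0 _.
  apply: leq_trans (knn_count Hd (fun j => xs j w) (X w) k0n) _.
  apply/subset_leq_card/fintype.subsetP => i; rewrite !inE.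
  by rewrite (dist_sym Hd).
by apply: measurable_card => i; exact: measurable_within.
Qed.

End measurable_knn.

(** * Estimates between counts, expected counts and masses *)

Section count_estimates.
Context {R : realType}.
Implicit Types (a k K N m v delta : R).

Lemma ler_norm_bounds (x y b : R) : `|x - y| <= b -> y - b <= x <= y + b.
Proof. by rewrite ler_norml => /andP[? ?]; apply/andP; split; rlra. Qed.

(** Here [m] and [N] are the expected and actual counts in a set, [mt] and [Nt]
    those of one class, [v] and [vt] the limiting values of [m] and [mt], and
    [a] is the posterior at the center. The chain
    [Nt ~ mt ~ vt ~ a v ~ a m ~ a N] accumulates an error [9 * delta * max k m],
    and [max k m <= 2 * N]. *)
Lemma class_count_close delta a k N Nt m mt v vt :
  0 < delta <= 4^-1 -> 0 <= a <= 1 -> 0 <= v -> 0 <= k ->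
  `|m - v| <= delta * v -> `|mt - vt| <= delta * v ->
  `|vt - a * v| <= delta * Num.max (3 * k) v ->
  `|N - m| <= delta * Num.max k m -> `|Nt - mt| <= delta * Num.max k m ->
  k <= N -> `|Nt - a * N| <= 18 * delta * N.
Proof.
move=> /andP[d0 d4] /andP[a0 a1] v0 k0 hm hmt hvt hN hNt kN.
set K := Num.max k m in hN hNt.
have kK : k <= K by rewrite le_max lexx.
have mK : m <= K by rewrite le_max lexx orbT.
have dv : delta * v <= 4^-1 * v by rewrite ler_wpM2r.
have v2K : v <= 2 * K by move: (ler_norm_bounds hm) => /andP[? ?]; rlra.
have K0 : 0 <= K by rlra.
have dK : delta * K <= 4^-1 * K by rewrite ler_wpM2r.
have K2N : K <= 2 * N.
  move: (ler_norm_bounds hN) => /andP[? ?].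
  have [mk|km] := leP m k.
    have KE : K = k by rewrite /K max_l.
    by rlra.
  have KE : K = m by rewrite /K max_r// ltW.
  by rlra.
have h1 : delta * v <= 2 * (delta * K) by rewrite mulrCA ler_pM2l.
have h2 : delta * Num.max (3 * k) v <= 3 * (delta * K).
  by rewrite mulrCA ler_pM2l// ge_max; apply/andP; split; rlra.
have dN : delta * K <= 2 * (delta * N) by rewrite mulrCA ler_pM2l.
have am : `|a * (v - m)| <= 2 * (delta * K).
  by rewrite normrM ger0_norm// distrC (le_trans _ h1)// (le_trans _ hm)// ler_piMl.
have aN : `|a * (m - N)| <= delta * K.
  by rewrite normrM ger0_norm// distrC (le_trans _ hN)// ler_piMl.
rewrite (_ : Nt - a * N =
  (Nt - mt) + (mt - vt) + (vt - a * v) + a * (v - m) + a * (m - N)); last by ring.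
have t1 := ler_normD (Nt - mt) (mt - vt).
have t2 := ler_normD (Nt - mt + (mt - vt)) (vt - a * v).
have t3 := ler_normD (Nt - mt + (mt - vt) + (vt - a * v)) (a * (v - m)).
have t4 := ler_normD (Nt - mt + (mt - vt) + (vt - a * v) + a * (v - m)) (a * (m - N)).
have -> : 18 * delta * N = 18 * (delta * N) by ring.
by rlra.
Qed.

(** A set of mass at least [(1 + 4 * delta) * k / n] contains [k] sample points. *)
Lemma count_lower delta k v m N :
  0 < delta <= 4^-1 -> 0 <= k -> (1 + 4 * delta) * k <= v ->
  `|m - v| <= delta * v -> `|N - m| <= delta * Num.max k m -> k <= N.
Proof.
move=> /andP[d0 d4] k0 kv hm hN.
move: (ler_norm_bounds hm) => /andP[hm1 _].
have m1 : (1 + delta) * k <= m.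
  apply: (@le_trans _ _ ((1 - delta) * ((1 + 4 * delta) * k))).
    rewrite mulrA ler_wpM2r//; nra.
  apply: (@le_trans _ _ ((1 - delta) * v)); last by rlra.
  by rewrite ler_wpM2l//; rlra.
have km : k <= m by apply: le_trans m1; rewrite ler_peMl//; rlra.
move: (ler_norm_bounds hN); rewrite max_r// => /andP[hN1 _].
apply: (@le_trans _ _ ((1 - delta) * m)); last by rlra.
apply: (@le_trans _ _ ((1 - delta) * ((1 - delta) * ((1 + 4 * delta) * k)))); last first.
  rewrite ler_wpM2l//; first by rlra.
  apply: (@le_trans _ _ ((1 - delta) * v)); last by rlra.
  by rewrite ler_wpM2l//; rlra.
rewrite !mulrA ler_peMl//; nra.
Qed.

(** A set of mass at most [(1 + 4 * delta) * k / n] contains few more than [k]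
    sample points. *)
Lemma count_upper delta k v m N :
  0 < delta <= 4^-1 -> 0 <= k -> 0 <= v -> v <= (1 + 4 * delta) * k ->
  `|m - v| <= delta * v -> `|N - m| <= delta * Num.max k m ->
  N <= (1 + 12 * delta) * k.
Proof.
move=> /andP[d0 d4] k0 v0 vk hm hN.
move: (ler_norm_bounds hm) => /andP[_ hm1].
move: (ler_norm_bounds hN) => /andP[_ hN1].
have K1 : Num.max k m <= (1 + delta) * ((1 + 4 * delta) * k).
  rewrite ge_max; apply/andP; split.
    by rewrite mulrA ler_peMl//; nra.
  apply: (@le_trans _ _ ((1 + delta) * v)); first by rlra.
  by rewrite ler_wpM2l//; rlra.
have mK : m <= Num.max k m by rewrite le_max lexx orbT.
apply: (@le_trans _ _ ((1 + delta) * Num.max k m)); first by rlra.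
apply: (@le_trans _ _ ((1 + delta) * ((1 + delta) * ((1 + 4 * delta) * k)))).
  by rewrite ler_wpM2l//; rlra.
rewrite !mulrA ler_wpM2r//; nra.
Qed.

(** The class ratio [Mt / M] inside a subset that misses at most
    [12 * delta * k] of the points. *)
Lemma ratio_close delta a k N Nt M Mt :
  0 < delta <= 4^-1 -> 0 <= a <= 1 -> 0 < k -> k <= M -> M <= N ->
  0 <= Nt - Mt <= N - M -> N <= (1 + 12 * delta) * k ->
  `|Nt - a * N| <= 18 * delta * N -> `|Mt / M - a| <= 84 * delta.
Proof.
move=> /andP[d0 d4] /andP[a0 a1] k0 kM MN /andP[h0 h1] Nk hN.
have M0 : 0 < M by apply: lt_le_trans kM.
rewrite (_ : Mt / M - a = (Mt - a * M) / M); last first.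
  by rewrite mulrBl mulfK// gt_eqF.
rewrite normrM normfV (ger0_norm (ltW M0)) ler_pdivrMr//.
have kM2 : delta * k <= delta * M by rewrite ler_wpM2l// ltW.
have NM : N <= 4 * M.
  apply: (le_trans Nk); apply: (@le_trans _ _ ((1 + 12 * delta) * M)).
    by rewrite ler_wpM2l//; rlra.
  by rewrite ler_wpM2r// ?(ltW M0)//; rlra.
have dNM : delta * N <= 4 * (delta * M) by rewrite mulrCA ler_wpM2l// ltW.
have hr : `|(Nt - Mt) - a * (N - M)| <= 12 * (delta * k).
  have ab : 0 <= a * (N - M) <= N - M.
    by rewrite mulr_ge0 ?subr_ge0//= ler_piMl// subr_ge0.
  rewrite ler_norml; move: ab => /andP[? ?].
  by apply/andP; split; rlra.
have t := ler_normB (Nt - a * N) ((Nt - Mt) - a * (N - M)).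
rewrite (_ : Mt - a * M = Nt - a * N - ((Nt - Mt) - a * (N - M))); last by ring.
have e1 : 18 * delta * N = 18 * (delta * N) by ring.
have e2 : 84 * delta * M = 84 * (delta * M) by ring.
by rewrite e1 in hN; rewrite e2; rlra.
Qed.

End count_estimates.

(** * Norms on real row vectors: cones and bounded overlap *)

(** The sets of the hypothesis form a chain indexed by values of [rho] on [A]. If
    the supremum of these values is attained, [A] is one of them; otherwise [A]
    is the union of an increasing sequence of smaller sets. *)
Lemma chain_measure_le d (T : measurableType d) (R : realType)
    (mu : {measure set T -> \bar R}) (A : set T) (rho : T -> R) (p : \bar R) :
  measurable A -> measurable_fun setT rho -> (0 <= p)%E ->
  (forall x, A x -> (mu (A `&` [set y | (rho y <= rho x)%R]) <= p)%E) ->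
  (mu A <= p)%E.
Proof.
move=> mA mrho p0 H.
have mle t : measurable (A `&` [set y | rho y <= t]).
  by apply: measurableI => //; apply: measurable_setle => //; exact: measurable_cst.
have le t x : A x -> t <= rho x -> (mu (A `&` [set y | (rho y <= t)%R]) <= p)%E.
  move=> Ax tx; apply: le_trans (H x Ax); apply: le_measure; rewrite ?inE//.
  by move=> y [Ay yt]; split => //=; exact: le_trans tx.
have chain (t : nat -> R) : nondecreasing_seq t ->
    (forall m, exists2 x, A x & t m <= rho x) ->
    (forall x, A x -> exists m, rho x <= t m) -> (mu A <= p)%E.
  move=> ndt tA At.
  rewrite (_ : A = \bigcup_m (A `&` [set y | rho y <= t m])); last first.
    apply/seteqP; split => [x Ax|x [m _ []]//].
    by have [m xm] := At x Ax; exists m.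
  apply: measure_bigcup_le => // [m n mn|m].
    apply/subsetPset => x [Ax xm]; split => //=; apply: le_trans xm _.
    exact: ndt.
  by have [x Ax xm] := tA m; exact: le xm.
have [->|/set0P[x0 Ax0]] := eqVneq A set0; first by rewrite measure0.
have [ub|nub] := pselect (has_ubound (rho @` A)); last first.
  apply: (chain (fun m => m%:R)) => [m n mn|m|x Ax]; first by rewrite ler_nat.
    apply: contrapT => h; apply: nub; exists m%:R => _ [x Ax <-].
    by rewrite leNgt; apply/negP => /ltW mx; apply: h; exists x.
  by exists (Num.truncn (rho x)).+1; rewrite ltW// truncnS_gt.
have hs : has_sup (rho @` A) by split => //; exists (rho x0), x0.
set s := sup (rho @` A).
have As x : A x -> rho x <= s by move=> Ax; apply: ub_le_sup => //; exists x.
have [[x Ax xs]|ns] := pselect (exists2 x, A x & rho x = s).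
  apply: le_trans (H x Ax); apply: le_measure; rewrite ?inE//.
  by move=> y Ay; split => //=; rewrite xs; exact: As.
apply: (chain (fun m => s - rad m)) => [m n mn|m|x Ax].
- by rewrite lerD2l lerN2 /rad lef_pV2 ?posrE// ler_nat.
- have [_ [x Ax <-] sx] := sup_adherent (rad_gt0 R m) hs.
  by exists x => //; exact: ltW.
- have xs : 0 < s - rho x.
    rewrite subr_gt0 lt_neqAle As// andbT; apply/eqP => e; apply: ns.
    by exists x.
  have [m /ltW mx] := rad_lt xs; exists m.
  by rewrite lerBrDr -lerBrDl.
Qed.

Section norm_on_rV.
Context {R : realType} {q : nat} (N : 'rV[R]_q -> R).
Hypothesis HN : is_norm N.

Lemma norm0 : N 0 = 0.
Proof. by rewrite -(scale0r 0) (norm_homogeneous HN) normr0 mul0r. Qed.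

Lemma normN x : N (- x) = N x.
Proof. by rewrite -scaleN1r (norm_homogeneous HN) normrN1 mul1r. Qed.

Lemma norm_ge0 x : 0 <= N x.
Proof.
have := norm_triangle HN x (- x); rewrite subrr norm0 normN.
by rewrite -mulr2n pmulrn_lge0.
Qed.

Lemma norm_distC x y : N (x - y) = N (y - x).
Proof. by rewrite -normN opprB. Qed.

Lemma norm_sum (I : Type) (r : seq I) (F : I -> 'rV[R]_q) :
  N (\sum_(i <- r) F i) <= \sum_(i <- r) N (F i).
Proof.
elim: r => [|i r IH]; first by rewrite !big_nil norm0.
by rewrite !big_cons (le_trans (norm_triangle HN _ _))// lerD2l.
Qed.

(** A constant that dominates [N] by the sup norm; the summand [1] keeps it
    positive in dimension [0]. *)
Definition norm_bound : R := 1 + \sum_(j < q) N 'e_j.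

Lemma norm_bound_gt0 : 0 < norm_bound.
Proof. by rewrite ltr_pwDl// sumr_ge0// => i _; exact: norm_ge0. Qed.

Lemma le_norm_coord (x : 'rV[R]_q) (e : R) : (forall j, `|x 0 j| <= e) -> 0 <= e ->
  N x <= norm_bound * e.
Proof.
move=> xe e0; rewrite [x in N x]row_sum_delta; apply: le_trans (norm_sum _ _) _.
rewrite /norm_bound mulrDl mul1r mulr_suml ler_wpDl//; apply: ler_sum => j _.
by rewrite (norm_homogeneous HN) mulrC ler_wpM2l// norm_ge0.
Qed.

Lemma norm_le_sup (x : 'rV[R]_q) : N x <= norm_bound * `|x|.
Proof.
apply: le_norm_coord => // j.
rewrite [leRHS]/Num.norm /= mx_normrE.
exact: (le_bigmax _ (fun ij : 'I_1 * 'I_q => `|x ij.1 ij.2|) (0, j)).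
Qed.

Lemma is_norm_continuous : continuous N.
Proof.
move=> x; apply/(cvgrPdist_lt (FF := nbhs_filter (x : 'rV[R]_q))) => e e0.
have d0 : 0 < e / norm_bound by rewrite divr_gt0// norm_bound_gt0.
apply: filterS (nbhsx_ballx x _ d0) => y; rewrite mx_norm_ball /ball_ /= => xy.
apply: (@le_lt_trans _ _ (N (x - y))).
  have h1 := norm_triangle HN (x - y) y; have h2 := norm_triangle HN (y - x) x.
  rewrite !subrK in h1 h2; rewrite (norm_distC y x) in h2.
  by rewrite ler_norml; apply/andP; split; rlra.
apply: le_lt_trans (norm_le_sup _) _.
by rewrite mulrC -ltr_pdivlMr ?norm_bound_gt0.
Qed.

(** Equivalence of norms: [N] is continuous and does not vanish on the compact
    unit sphere of the sup norm. *)
Lemma sup_le_norm : exists2 c : R, 0 < c & forall x : 'rV[R]_q, c * `|x| <= N x.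
Proof.
have csph : compact [set x : 'rV[R]_q | `|x| = 1].
  apply: bounded_closed_compact.
    by exists 1; split => // M M1 x /= ->; exact: ltW.
  have /continuous_closedP cn := @norm_continuous R 'rV[R]_q.
  exact: (cn _ (@closed_eq _ 1)).
have cimg : closed (N @` [set x : 'rV[R]_q | `|x| = 1]).
  apply: compact_closed; first exact: Rhausdorff.
  apply: continuous_compact => //; apply: continuous_subspaceT.
  exact: is_norm_continuous.
have n0 : ~ (N @` [set x : 'rV[R]_q | `|x| = 1]) 0.
  move=> [x /= x1 /(norm_definite HN) x0]; move: x1; rewrite x0 normr0.
  by move/esym/eqP; rewrite oner_eq0.
have : nbhs (0 : R) (~` (N @` [set x : 'rV[R]_q | `|x| = 1])).
  by apply: open_nbhs_nbhs; split => //; exact: closed_openC.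
move=> /nbhs_ballP[c /= c0 cN]; exists c => // x.
have [->|x0] := eqVneq x 0; first by rewrite normr0 mulr0 norm_ge0.
have nx0 : 0 < `|x| by rewrite normr_gt0.
rewrite -ler_pdivlMr// leNgt; apply/negP => H.
apply: (cN (N (`|x|^-1 *: x))).
  rewrite /ball /= sub0r normrN ger0_norm ?norm_ge0//.
  by rewrite (norm_homogeneous HN) ger0_norm ?invr_ge0// mulrC.
exists (`|x|^-1 *: x) => //=.
by rewrite normrZ ger0_norm ?invr_ge0// mulVf// gt_eqF.
Qed.

Lemma norm_metrizes : metrizes (S := 'rV[R]_q) (fun x y => N (x - y)).
Proof.
have [c c0 cN] := sup_le_norm.
split.
- by move=> x; rewrite subrr norm0.
- by move=> x y /(norm_definite HN)/eqP; rewrite subr_eq0 => /eqP.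
- exact: norm_distC.
- move=> x y z; rewrite (_ : x - z = (x - y) + (y - z)); last by rewrite addrA subrK.
  exact: norm_triangle.
- move=> x r; have cxN : continuous (fun y : 'rV[R]_q => N (x - y)).
    have cd : continuous (fun y : 'rV[R]_q => x - y).
      by move=> y; have FF := nbhs_filter y; apply: cvgB; [exact: cvg_cst|exact: cvg_id].
    by move=> y; exact: (continuous_comp (cd y) (@is_norm_continuous _)).
  by move/continuousP: cxN => /(_ _ (open_lt (y := r))).
- move=> U x oU Ux.
  have /nbhs_ballP[e /= e0 eU] : nbhs x U by apply: open_nbhs_nbhs.
  exists (c * e); first exact: mulr_gt0.
  move=> y /= xy; apply: eU; rewrite mx_norm_ball /ball_ /=.
  by rewrite -(ltr_pM2l c0); exact: le_lt_trans (cN _) xy.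
- exists (fun n => if unpickle n is Some u then map_mx ratr (u : 'rV[rat]_q) else 0).
  move=> x r r0; pose e := r / norm_bound / 2.
  have e0 : 0 < e by rewrite !divr_gt0 ?norm_bound_gt0.
  have /fin_all_exists[u ux] : forall j, exists t : rat, `|ratr t - x 0 j| <= e.
    move=> j; have [t] : exists t : rat, ratr t \in `](x 0 j - e), (x 0 j + e)[.
      by apply: rat_in_itvoo; rewrite ltrD2l; move: e0; rlra.
    rewrite in_itv/= => /andP[t1 t2]; exists t.
    by rewrite ler_norml; apply/andP; split; move: t1 t2; rlra.
  exists (pickle (\row_j u j)); rewrite pickleK.
  apply: (@le_lt_trans _ _ (norm_bound * e)).
    by apply: le_norm_coord; [move=> j; rewrite !mxE|exact: ltW].
  rewrite /e mulrA mulrCA mulfV ?gt_eqF ?norm_bound_gt0// mulr1.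
  by move: r0; rlra.
Qed.

Lemma norm_scaled_continuous (y z : 'rV[R]_q) :
  continuous (fun x : 'rV[R]_q => N ((x - y) - N (x - y) *: z)).
Proof.
have cd : continuous (fun x : 'rV[R]_q => x - y).
  by move=> x; have FF := nbhs_filter x; apply: cvgB; [exact: cvg_id|exact: cvg_cst].
have cN : continuous (fun x : 'rV[R]_q => N (x - y)).
  by move=> x; exact: (continuous_comp (cd x) (@is_norm_continuous _)).
have cz : continuous (fun x : 'rV[R]_q => x - y - N (x - y) *: z).
  move=> x; have FF := nbhs_filter x; apply: cvgB; first exact: cd.
  by apply: cvgZ; [exact: cN|exact: cvg_cst].
by move=> x; exact: (continuous_comp (cz x) (@is_norm_continuous _)).
Qed.

(** For a point [z] of norm [1], the vectors whose direction is within distance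
    [2^-1] of [z]; the vector [0] is excluded by the strict inequality. *)
Definition cone (z : 'rV[R]_q) : set 'rV[R]_q :=
  [set u | N (u - N u *: z) < N u / 2].

(** Inside a cone, the farther of two vectors is closer to the other one than to
    the apex. Shrinking [v] to [t *: v], of the norm of [u], moves it by
    [N v - N u], and [t *: v] is at distance less than [N u] of [u]. *)
Lemma cone_closer (z u v : 'rV[R]_q) : cone z u -> cone z v -> N u <= N v ->
  N (v - u) < N v.
Proof.
rewrite /cone /= => uz vz uv; have u0 : 0 < N u.
  by have := norm_ge0 (u - N u *: z); move: uz; rlra.
have v0 : 0 < N v by apply: lt_le_trans uv.
pose t := N u / N v.
have t0 : 0 <= t by rewrite divr_ge0// norm_ge0.
have t1 : t <= 1 by rewrite ler_pdivrMr// mul1r.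
have tv : t * N v = N u by rewrite divfK// gt_eqF.
have e : v - u = (1 - t) *: v + (t *: (v - N v *: z) - (u - N u *: z)).
  by apply/rowP => j; rewrite !mxE -tv; ring.
rewrite e; apply: le_lt_trans (norm_triangle HN _ _) _.
have h := norm_triangle HN (t *: (v - N v *: z)) (- (u - N u *: z)).
rewrite normN !(norm_homogeneous HN) (ger0_norm t0) in h.
rewrite (norm_homogeneous HN) ger0_norm ?subr_ge0//.
have h2 : t * N (v - N v *: z) <= t * (N v / 2) by rewrite ler_wpM2l// ltW.
by move: tv h h2 uz vz; rewrite !mulrA => tv; rewrite tv mulrBl mul1r tv; rlra.
Qed.

(** Compactness of the unit sphere of [N], covered by balls of radius [2^-1]. *)
Lemma finite_cones : exists Z : seq 'rV[R]_q,
  forall u, u != 0 -> exists2 z, z \in Z & cone z u.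
Proof.
have [c c0 cN] := sup_le_norm.
have csph : compact [set x : 'rV[R]_q | N x = 1].
  apply: bounded_closed_compact.
    exists c^-1; split; first exact: num_real.
    move=> M cM x /= Nx; apply: le_trans (ltW cM).
    by rewrite -[leRHS]mulr1 ler_pdivlMl// -Nx.
  have /continuous_closedP cn := is_norm_continuous.
  exact: (cn _ (@closed_eq _ 1)).
rewrite compact_cover in csph.
have := csph 'rV[R]_q setT (fun z => [set u | N (z - u) < 2^-1]).
case=> [z _||D _ DN].
- exact: (oball_open norm_metrizes z 2^-1).
- move=> u _; exists u => //=; rewrite subrr norm0; by rlra.
exists (finmap.enum_fset D) => u u0.
have Nu : 0 < N u.
  rewrite lt_neqAle norm_ge0 andbT eq_sym; apply: contra u0 => /eqP.
  by move/(norm_definite HN) ->.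
have [|z /= zD zu] := DN ((N u)^-1 *: u).
  by rewrite /= (norm_homogeneous HN) ger0_norm ?invr_ge0 ?(ltW Nu)// mulVf// gt_eqF.
exists z => //; rewrite /cone /=.
have -> : u - N u *: z = (- N u) *: (z - (N u)^-1 *: u).
  by apply/rowP => j; rewrite !mxE; field; rewrite gt_eqF.
by rewrite (norm_homogeneous HN) normrN ger0_norm ?(ltW Nu)// ltr_pM2l.
Qed.

Local Notation dist := (fun x y : 'rV[R]_q => N (x - y)).

(** Cover the space by finitely many cones with apex [y]. If [x0] is a center in
    one of them whose ball contains [y], then by [cone_closer] all the centers of
    the same cone that are not farther from [y] lie in the open ball about [x0],
    of mass at most [p]. By [chain_measure_le] each cone contributes at most
    [p]. *)
Lemma norm_bounded_overlap (mu : probability (borel 'rV[R]_q) R) :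
  exists2 g : R, 0 <= g & bounded_overlap dist mu g.
Proof.
have [Z Zcone] := finite_cones; exists (size Z)%:R => // p y /andP[p0 p1].
set r := qradius dist mu p.
have Hd := norm_metrizes.
have mr : measurable_fun setT (r : borel 'rV[R]_q -> R).
  exact: measurable_qradius.
pose B z : set (borel 'rV[R]_q) := [set x | cone z (x - y)] `&` [set x | N (x - y) <= r x].
have mN : measurable_fun setT (fun x : borel 'rV[R]_q => N (x - y)).
  apply: (@measurable_dist_comp _ _ _ Hd _ (borel 'rV[R]_q) id (cst y)) => //.
have mB z : measurable (B z).
  apply: measurableI; last exact: measurable_setle.
  apply: measurable_setlt; first by apply: continuous_borel; exact: norm_scaled_continuous.
  by apply: measurable_funM.
have muB z : (mu (B z) <= p%:E)%E.
  apply: (@chain_measure_le _ _ _ mu (B z) (fun x => N (x - y))) => //.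
    by rewrite lee_fin ltW.
  move=> x0 [zx0 rx0]; apply: le_trans (oball_qradius Hd mu x0 (ltW p0)).
  apply: le_measure; rewrite ?inE.
  - by apply: measurableI => //; apply: measurable_setle => //; exact: measurable_cst.
  - exact: (measurable_ball_lt Hd).
  - move=> x [[zx rx] xx0]; rewrite /oball /=.
    apply: lt_le_trans rx0; rewrite (_ : x0 - x = (x0 - y) - (x - y)).
      exact: (cone_closer zx zx0 xx0).
    by rewrite opprB addrA subrK.
have sub : [set x | x <> y /\ N (x - y) <= r x] `<=` \big[setU/set0]_(z <- Z) B z.
  move=> x [/eqP xy rx]; have [|z zZ zx] := Zcone (x - y); first by rewrite subr_eq0.
  by rewrite -bigcup_seq; exists z.
have mU s : measurable (\big[setU/set0]_(z <- s) B z).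
  by apply: bigsetU_measurable => z _; exact: mB.
have mx : measurable ([set x | x <> y /\ N (x - y) <= r x] : set (borel 'rV[R]_q)).
  rewrite (_ : [set x | _] = [set x : borel 'rV[R]_q | 0 < N (x - y)] `&`
      [set x | N (x - y) <= r x]).
    apply: measurableI; last exact: measurable_setle.
    by apply: measurable_setlt => //; exact: measurable_cst.
  apply/seteqP; split => x [xy rx]; split => //=.
    rewrite lt_neqAle norm_ge0 andbT eq_sym; apply/eqP => /(norm_definite HN)/eqP.
    by rewrite subr_eq0 => /eqP.
  by move=> e; move: xy; rewrite e /= subrr norm0 ltxx.
apply: (@le_trans _ _ (mu (\big[setU/set0]_(z <- Z) B z))).
  by apply: le_measure; rewrite ?inE.
elim: Z {Zcone sub} => [|z Z IH]; first by rewrite big_nil measure0 mul0r.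
rewrite big_cons; apply: (le_trans (measureU2 mu (mB z) (mU Z))).
by rewrite -natr1 mulrDl mul1r EFinD [leLHS]addeC; apply: leeD; [exact: IH|exact: muB].
Qed.

End norm_on_rV.

(** * Change of measure and the Markov inequality *)

Section density.
Context {R : realType} {d : measure_display} {T : measurableType d}.
Context (nu M : {measure set T -> \bar R}) (s : T -> R).
Hypotheses (ms : measurable_fun setT s) (s_ge0 : forall x, 0 <= s x).
Hypothesis nuE : forall A, measurable A -> nu A = (\int[M]_(x in A) (s x)%:E)%E.

Import HBNNSimple.

Let integral_density_indic (E : set T) : measurable E ->
  (\int[nu]_x (\1_E x)%:E = \int[M]_x ((\1_E x)%:E * (s x)%:E))%E.
Proof.
move=> mE; rewrite integral_indic// setIT nuE// integral_mkcond.
apply: eq_integral => x _; rewrite patchE indicE.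
by case: (x \in E); rewrite ?mul1e ?mul0e.
Qed.

Let integral_density_nnsfun (f : {nnsfun T >-> R}) :
  (\int[nu]_x (f x)%:E = \int[M]_x ((f x)%:E * (s x)%:E))%E.
Proof.
have mI r : measurable (f @^-1` [set r]) by [].
under [LHS]eq_integral do rewrite fimfunE -fsumEFin//.
rewrite [LHS]ge0_integral_fsum//; last 2 first.
- by move=> r; exact/measurable_EFinP/measurableT_comp.
- by move=> n x _; rewrite EFinM nnfun_muleindic_ge0.
under [RHS]eq_integral.
  move=> x xD; rewrite fimfunE -fsumEFin// muleC ge0_mule_fsumr; last first.
    by move=> r; rewrite EFinM nnfun_muleindic_ge0.
  over.
rewrite [RHS]ge0_integral_fsum//; last 2 first.
- move=> r; apply: emeasurable_funM; first exact/measurable_EFinP.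
  by apply/measurable_EFinP; exact: measurableT_comp.
- move=> n x _; rewrite EFinM mule_ge0// ?lee_fin//.
  by rewrite -lee_fin EFinM nnfun_muleindic_ge0.
apply: eq_fsbigr => r _.
rewrite integralZl_indic_nnsfun//= integral_density_indic//.
have [r0|r0] := leP 0 r; last first.
  rewrite preimage_nnfun0//.
  rewrite !integral0_eq ?mule0// => x _; rewrite indic0 ?mulr0 ?mul0e ?mule0//.
rewrite -ge0_integralZl//; last 2 first.
- apply: emeasurable_funM; apply/measurable_EFinP => //.
- by move=> x _; rewrite -EFinM lee_fin mulr_ge0.
by apply: eq_integral => x _; rewrite EFinM [RHS]muleC -muleA.
Qed.

(** Change of measure, from indicators to simple functions to monotone limits. *)
Lemma ge0_integral_density (g : T -> \bar R) :
  measurable_fun setT g -> (forall x, 0 <= g x)%E ->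
  (\int[nu]_x g x = \int[M]_x (g x * (s x)%:E))%E.
Proof.
move=> mg g0; pose g_ := nnsfun_approx measurableT mg.
transitivity (limn (fun n => \int[nu]_x (g_ n x)%:E))%E.
  rewrite -monotone_convergence//=.
  - apply: eq_integral => x _; apply/esym/cvg_lim => //=.
    exact: cvg_nnsfun_approx.
  - by move=> n; exact/measurable_EFinP/measurable_funTS.
  - by move=> n x _; rewrite lee_fin.
  - by move=> x _ m n mn; rewrite lee_fin; exact/lefP/nd_nnsfun_approx.
transitivity (limn (fun n => \int[M]_x ((g_ n x)%:E * (s x)%:E)))%E.
  by congr (limn _); apply/funext => n; exact: integral_density_nnsfun.
rewrite -monotone_convergence//=.
- apply: eq_integral => x _; apply/cvg_lim => //=.
  by apply: cvgeZr => //; exact: cvg_nnsfun_approx.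
- by move=> n; apply: emeasurable_funM; apply/measurable_EFinP => //; exact/measurable_funTS.
- by move=> n x _; rewrite -EFinM lee_fin mulr_ge0.
- move=> x _ m n mn; rewrite lee_wpmul2r// ?lee_fin//; exact/lefP/nd_nnsfun_approx.
Qed.

End density.

Lemma ge0_markov d (T : measurableType d) (R : realType)
    (mu : {measure set T -> \bar R}) (g : T -> \bar R) (e : R) : 0 < e ->
  measurable_fun setT g -> (forall x, 0 <= g x)%E ->
  (mu [set x | (e%:E <= g x)%E] <= (e^-1)%:E * \int[mu]_x g x)%E.
Proof.
move=> e0 mg g0; set A := [set x | _].
have mA : measurable A.
  by rewrite -[A]setTI; exact: emeasurable_fun_c_infty.
rewrite -[A]setIT -integral_indic// -ge0_integralZl//; last first.
  by rewrite lee_fin invr_ge0 ltW.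
apply: ge0_le_integral => //.
- by apply/measurable_EFinP; exact: measurable_indic.
- exact: emeasurable_funM.
move=> x _; rewrite indicE; have [/set_mem Ax|_] := boolP (x \in A).
  rewrite -[leLHS](_ : ((e^-1)%:E * e%:E)%E = _); last first.
    by rewrite -EFinM mulVf ?gt_eqF.
  by apply: lee_wpmul2l => //; rewrite lee_fin invr_ge0 ltW.
by apply: mule_ge0 => //; rewrite lee_fin invr_ge0 ltW.
Qed.

(** * From counts to the nearest neighbor weight *)

Section knn_sandwich.
Context {R : realType} {S : ptopologicalType} (dist : S -> S -> R).
Hypothesis Hd : metrizes dist.
Context (n L : nat) (xs : 'I_n -> S) (lab : 'I_n -> 'I_L) (theta : 'I_L).
Context (k : nat) (k0n : (0 < k <= n)%N) (x : S).

(** The hypotheses of [class_count_close], for the closed or the open ball. *)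
Definition counts_close (delta a v vt m mt N Nt : R) : Prop :=
  [/\ `|m - v| <= delta * v, `|mt - vt| <= delta * v,
      `|vt - a * v| <= delta * Num.max (3 * k%:R) v,
      `|N - m| <= delta * Num.max k%:R m & `|Nt - mt| <= delta * Num.max k%:R m].

(** By [count_lower] the radius [r] of the reference balls is not exceeded by the
    nearest neighbor radius. If they are equal, the neighbors are the points of
    the closed ball. Otherwise they all lie in the open ball, which by
    [count_upper] contains few other points. Treating these two cases with
    different balls is what makes ties harmless. *)
Lemma knn_weight_close (delta a r vc vtc mc mtc vo vto mo mto : R) :
  0 < delta <= 4^-1 -> 0 <= a <= 1 -> 0 <= r ->
  (1 + 4 * delta) * k%:R <= vc -> 0 <= vo <= (1 + 4 * delta) * k%:R ->
  counts_close delta a vc vtc mc mtc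
    #|[pred i : 'I_n | dist x (xs i) <= r]|%:R
    #|[pred i : 'I_n | (lab i == theta) && (dist x (xs i) <= r)]|%:R ->
  counts_close delta a vo vto mo mto
    #|[pred i : 'I_n | dist x (xs i) < r]|%:R
    #|[pred i : 'I_n | (lab i == theta) && (dist x (xs i) < r)]|%:R ->
  `|knn_weight dist xs lab k theta x - a| <= 84 * delta.
Proof.
move=> dd a01 r0 kvc /andP[vo0 vok] [c1 c2 c3 c4 c5] [ho1 ho2 ho3 ho4 ho5].
have k0 : 0 < k%:R :> R by rewrite ltr0n; case/andP: k0n.
have d0 : 0 < delta by case/andP: dd.
set rh := knn_radius dist xs k x.
have kNc := count_lower dd (ltW k0) kvc c1 c4.
have rhr : rh <= r by apply: (knn_radius_le r0); rewrite -(ler_nat R).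
have kM : k%:R <= #|[pred i : 'I_n | dist x (xs i) <= rh]|%:R :> R.
  by rewrite ler_nat; exact: (knn_count Hd xs x k0n).
have vc0 : 0 <= vc by apply: le_trans kvc; rewrite mulr_ge0 ?(ltW k0)// addr_ge0// mulr_ge0// ltW.
rewrite /knn_weight -/rh.
rewrite (eq_card (B := [pred i : 'I_n | (lab i == theta) && (dist x (xs i) <= rh)]));
  last by move=> i; rewrite !inE (dist_sym Hd x).
rewrite (eq_card (A := [pred i : 'I_n | dist (xs i) x <= rh])
   (B := [pred i : 'I_n | dist x (xs i) <= rh]));
  last by move=> i; rewrite !inE (dist_sym Hd x).
have [rhE|rh_neq] := eqVneq rh r.
  rewrite rhE; have := class_count_close dd a01 vc0 (ltW k0) c1 c2 c3 c4 c5 kNc.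
  move: kNc; set N := #|[pred i : 'I_n | dist x (xs i) <= r]|%:R.
  set Nt := #|[pred i : 'I_n | (lab i == theta) && (dist x (xs i) <= r)]|%:R => kNc h.
  have N0 : 0 < N by apply: lt_le_trans kNc.
  rewrite (_ : Nt / N - a = (Nt - a * N) / N); last by rewrite mulrBl mulfK// gt_eqF.
  rewrite normrM normfV (ger0_norm (ltW N0)) ler_pdivrMr//.
  apply: (le_trans h); rewrite ler_wpM2r ?(ltW N0)// ler_wpM2r ?(ltW d0)//.
  by rewrite ler_nat.
have {rhr rh_neq}rhr : rh < r by rewrite lt_neqAle rh_neq.
have sub i : (dist x (xs i) <= rh) ==> (dist x (xs i) < r).
  by apply/implyP => /le_lt_trans; apply.
have MN : #|[pred i : 'I_n | dist x (xs i) <= rh]|%:R <=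
    #|[pred i : 'I_n | dist x (xs i) < r]|%:R :> R.
  rewrite ler_nat; apply/subset_leq_card/fintype.subsetP => i; rewrite !inE.
  exact/implyP.
have kNo := le_trans kM MN.
apply: (ratio_close dd a01 k0 kM MN _ (count_upper dd (ltW k0) vo0 vok ho1 ho4)
  (class_count_close dd a01 vo0 (ltW k0) ho1 ho2 ho3 ho4 ho5 kNo)).
rewrite !card_natrE -!sumrB; apply/andP; split.
  apply: sumr_ge0 => i _ /=; have := sub i.
  by case: (lab i == theta); case: (_ <= rh); case: (_ < r) => //=; rewrite ?subr0 ?subrr.
apply: ler_sum => i _ /=; have := sub i.
by case: (lab i == theta); case: (_ <= rh); case: (_ < r) => //=; rewrite ?subr0 ?subrr.
Qed.

End knn_sandwich.

(** * Class masses and the posterior *)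

Section knn_core.
Context {R : realType} {L : nat}.
Context {S : ptopologicalType} (dist : S -> S -> R) (f : 'I_L -> S -> R).
Hypothesis Hd : metrizes dist.
Context {d : measure_display} {Omega : measurableType d} (P : probability Omega R).
Context (X : Omega -> borel S) (mX : measurable_fun setT X) (Y : Omega -> 'I_L).
Hypothesis mY : forall b, measurable (Y @^-1` [set b]).
Hypothesis prior_gt0 : forall b, 0 < prior P Y b.
Context (M : {measure set (borel S) -> \bar R}).
Hypothesis f_gt0 : forall b x, 0 < f b x.
Hypothesis mf : forall b, measurable_fun setT (f b : borel S -> R).
Hypothesis f_density : forall b (A : set (borel S)), measurable A ->
  class_law P Y X b A = (\int[M]_(x in A) (f b x)%:E)%E.
Context (theta : 'I_L).

Let w := prior P Y.
Let u : S -> R := posterior w f theta.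
Let mu := law P mX.

Definition class_mass (b : 'I_L) (A : set (borel S)) : R := fine (class_law P Y X b A).

Let mXA (A : set (borel S)) : measurable A -> measurable (X @^-1` A).
Proof. by move=> mA; rewrite -[X in measurable X]setTI; exact: mX. Qed.

Let fin_joint b (A : set (borel S)) : measurable A ->
  P (X @^-1` A `&` Y @^-1` [set b]) \is a fin_num.
Proof. by move=> mA; apply: fin_num_measure; apply: measurableI => //; exact: mXA. Qed.

Lemma class_massE b (A : set (borel S)) : measurable A ->
  (w b * class_mass b A)%:E = P (X @^-1` A `&` Y @^-1` [set b]).
Proof.
move=> mA; rewrite /class_mass /class_law /= -/w mulrC divfK ?fineK ?gt_eqF ?prior_gt0//.
exact: fin_joint.
Qed.

Lemma class_mass_ge0 b (A : set (borel S)) : 0 <= class_mass b A.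
Proof. by rewrite divr_ge0 ?fine_ge0. Qed.

Lemma class_mass_law b (A : set (borel S)) :
  (class_mass b A)%:E = class_law P Y X b A.
Proof. by []. Qed.

Lemma feature_mass (A : set (borel S)) : measurable A ->
  mu A = (\sum_b w b * class_mass b A)%:E.
Proof.
move=> mA; rewrite -[LHS]/(P (X @^-1` A)).
rewrite -sumEFin; under eq_bigr do rewrite class_massE//.
have E : X @^-1` A = \big[setU/set0]_b (X @^-1` A `&` Y @^-1` [set b]).
  rewrite -bigcup_seq; apply/seteqP; split => [x Ax|x [b _ []]//].
  by exists (Y x) => //=; rewrite mem_index_enum.
rewrite {1}E measure_bigsetU_ord//; first by move=> b; apply: measurableI => //; exact: mXA.
by move=> b c _ _ [x [[_ /= <-] [_ /= <-]]].
Qed.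

Let s (x : borel S) : R := \sum_b w b * f b x.

Let w_gt0 b : 0 < w b. Proof. exact: prior_gt0. Qed.

Let s_ge x : w theta * f theta x <= s x.
Proof.
rewrite /s (bigD1 theta)//= lerDl sumr_ge0// => b _.
by rewrite mulr_ge0// ltW.
Qed.

Let s_gt0 x : 0 < s x.
Proof. by apply: lt_le_trans (s_ge x); rewrite mulr_gt0. Qed.

Let ms : measurable_fun setT s.
Proof. by apply: measurable_sum => b; apply: measurable_funM. Qed.

Lemma posterior01 x : 0 <= u x <= 1.
Proof.
rewrite /u /posterior -/(s x); apply/andP; split.
  by rewrite divr_ge0 ?mulr_ge0 ?(ltW (s_gt0 x)) ?(ltW (w_gt0 _)) ?(ltW (f_gt0 _ _)).
by rewrite ler_pdivrMr// mul1r.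
Qed.

Lemma measurable_posterior : measurable_fun setT (u : borel S -> R).
Proof.
apply: measurable_funM; first exact: measurable_funM.
by apply: measurable_funV_gt0.
Qed.

Let mu_density (A : set (borel S)) : measurable A -> mu A = (\int[M]_(x in A) (s x)%:E)%E.
Proof.
move=> mA; rewrite feature_mass// /s.
under eq_integral do rewrite -sumEFin.
have mwf b : measurable_fun A (fun x : borel S => (w b * f b x)%:E).
  by apply: measurable_funTS; apply/measurable_EFinP; exact: measurable_funM.
rewrite ge0_integral_sum//; last by move=> b x _; rewrite lee_fin mulr_ge0// ltW.
rewrite -sumEFin; apply: eq_bigr => b _; under eq_integral do rewrite EFinM.
rewrite ge0_integralZl//; last 3 first.
- by apply: measurable_funTS; exact/measurable_EFinP.
- by move=> x _; rewrite lee_fin ltW.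
- by rewrite lee_fin ltW.
by rewrite -f_density// EFinM class_mass_law.
Qed.

(** Under the law of [X], of density [\sum_b w b * f b] with respect to [M], the
    posterior is the density of the joint measure of class [theta]. *)
Lemma integral_posterior (A : set (borel S)) : measurable A ->
  (\int[mu]_(x in A) (u x)%:E = (w theta * class_mass theta A)%:E)%E.
Proof.
move=> mA; have mU := measurable_posterior.
have mI : measurable_fun setT (fun x : borel S => (\1_A x : R)) by exact: measurable_indic.
rewrite integral_mkcond.
rewrite (eq_integral (fun x : borel S => (\1_A x * u x)%:E)); last first.
  by move=> x _; rewrite patchE indicE; case: (x \in A); rewrite ?mul1r ?mul0r.
rewrite (ge0_integral_density ms _ mu_density)//; last 3 first.
- by move=> x; rewrite ltW.
- by apply/measurable_EFinP; exact: measurable_funM.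
- by move=> x; rewrite lee_fin mulr_ge0//; have /andP[] := posterior01 x.
rewrite EFinM class_mass_law f_density// -ge0_integralZl//; last 3 first.
- by apply: measurable_funTS; exact/measurable_EFinP.
- by move=> x _; rewrite lee_fin ltW.
- by rewrite lee_fin ltW.
rewrite [RHS]integral_mkcond; apply: eq_integral => x _.
rewrite patchE indicE -!EFinM; case: (x \in A); last by rewrite !mul0r.
by rewrite mul1r /u /posterior -/(s x) divfK// gt_eqF.
Qed.

(** The class mass of the section minus the value predicted by the posterior at
    the center is the integral of [u y - u x] over the section. *)
Lemma oscillation_bound (p delta : R) (C : set (borel S * borel S)) (x : borel S) :
  0 < p < 1 -> measurable C -> 0 <= delta ->
  (\int[mu]_y (avg_kernel mu p C (x, y) * `|u y - u x|)%:E <= delta%:E)%E ->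
  `|w theta * class_mass theta (xsection C x) - u x * mass mu C x|
    <= delta * Num.max p (mass mu C x).
Proof.
move=> p01 mC delta0 osc; set A := xsection C x.
have mA : measurable A by exact: measurable_xsection.
have mU := measurable_posterior.
set m := Num.max p _.
have m0 : 0 < m by rewrite lt_max; case/andP: p01 => ->.
have muA : (mu A < +oo)%E by rewrite (le_lt_trans (probability_le1 _ _)) ?ltry.
have intU : mu.-integrable A (EFin \o (u : borel S -> R)).
  apply: measurable_bounded_integrable => //; first exact: measurable_funTS.
  exists 1; split; first exact: num_real.
  move=> B B1 y _; have /andP[? ?] := posterior01 y.
  by rewrite /= ger0_norm// (le_trans _ (ltW B1)).
have intc : mu.-integrable A (EFin \o (fun _ : borel S => u x)).
  exact: finite_measure_integrable_cst.
have -> : w theta * class_mass theta A = (\int[mu]_(y in A) u y)%R.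
  by rewrite /Rintegral integral_posterior.
have -> : u x * mass mu C x = (\int[mu]_(y in A) (fun=> u x) y)%R.
  by rewrite Rintegral_cst.
rewrite -RintegralB//; apply: le_trans (le_normr_Rintegral mA _) _.
  by apply: (integrableB mA intU intc).
rewrite -lee_fin /Rintegral fineK; last first.
  apply: integrable_fin_num => //.
  exact: (integrable_abse (integrableB mA intU intc)).
rewrite mulrC EFinM.
apply: (@le_trans _ _ (m%:E * \int[mu]_y (avg_kernel mu p C (x, y) * `|u y - u x|)%:E)%E);
  last by apply: lee_wpmul2l => //; rewrite lee_fin ltW.
have mk0 : measurable_fun setT (avg_kernel mu p C) by exact: measurable_avg_kernel.
have mk : measurable_fun setT (fun y : borel S => (avg_kernel mu p C (x, y) * `|u y - u x|)%:E).
  apply/measurable_EFinP; apply: measurable_funM.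
    exact: (measurableT_comp mk0 (pair1_measurable x)).
  by apply: measurableT_comp => //; apply: measurable_funB.
rewrite -ge0_integralZl//; last 2 first.
- by move=> y _; rewrite lee_fin mulr_ge0//; exact: avg_kernel_ge0.
- by rewrite lee_fin ltW.
rewrite integral_mkcond le_eqVlt; apply/orP; left; apply/eqP; apply: eq_integral => y _.
rewrite patchE /avg_kernel -/m indic_xsection indicE -EFinM.
by case: (y \in A); rewrite ?mul0r ?mulr0// mul1r mulrA mulfV ?mul1r// gt_eqF.
Qed.

End knn_core.

(** * Convergence in probability of the nearest neighbor weight *)

Section knn_convergence.
Context {R : realType} {L : nat}.
Context {S : ptopologicalType} (dist : S -> S -> R) (f : 'I_L -> S -> R).
Hypothesis Hd : metrizes dist.
Context {d : measure_display} {Omega : measurableType d} (P : probability Omega R).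
Context (X : Omega -> borel S) (mX : measurable_fun setT X) (Y : Omega -> 'I_L).
Hypothesis mY : forall b, measurable (Y @^-1` [set b]).
Hypothesis prior_gt0 : forall b, 0 < prior P Y b.
Context (M : {measure set (borel S) -> \bar R}).
Hypothesis f_gt0 : forall b x, 0 < f b x.
Hypothesis mf : forall b, measurable_fun setT (f b : borel S -> R).
Hypothesis f_density : forall b (A : set (borel S)), measurable A ->
  class_law P Y X b A = (\int[M]_(x in A) (f b x)%:E)%E.
Context (theta : 'I_L).
Context (lab : forall n : nat, 'I_n -> 'I_L).
Context (xs : forall n : nat, 'I_n -> Omega -> borel S).
Arguments xs : clear implicits.
Arguments lab : clear implicits.
Hypothesis mxs : forall n i, measurable_fun setT (xs n i).
Hypothesis xs_indep : forall n, sample_independent P Y X (xs n).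
Hypothesis xs_law : forall n i (A : set (borel S)), measurable A ->
  P (xs n i @^-1` A) = class_law P Y X (lab n i) A.
Context (k : nat -> nat).
Hypothesis k_bounds : \forall n \near \oo, (0 < k n <= n)%N.

Let w := prior P Y.
Let u : S -> R := posterior w f theta.
Let mu := law P mX.
Let cmass := class_mass P X Y.

Let indep n (A : 'I_n -> set (borel S)) (B : set (borel S)) :
  (forall i, measurable (A i)) -> measurable B ->
  P ((\bigcap_i (xs n i @^-1` A i)) `&` X @^-1` B) =
  ((\prod_(i < n) P (xs n i @^-1` A i)) * P (X @^-1` B))%E.
Proof. by move=> mA mB; exact: (xs_indep mA (fun=> mB)). Qed.

Lemma hit_prob_class n (C : set (borel S * borel S)) i x : measurable C ->
  hit_prob P (xs n) C i x = cmass (lab n i) (xsection C x).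
Proof. by move=> mC; rewrite /hit_prob xs_law//; exact: measurable_xsection. Qed.

Lemma sum_over_labels n (F : 'I_L -> R) :
  \sum_(i < n) F (lab n i) = \sum_b (group_size (lab n) b)%:R * F b.
Proof.
rewrite (partition_big (lab n) xpredT)//=; apply: eq_bigr => b _.
rewrite (eq_bigr (fun=> F b)); last by move=> i /eqP ->.
by rewrite sumr_const mulr_natl.
Qed.

Lemma mean_hits_all n (C : set (borel S * borel S)) x : measurable C ->
  mean_hits P (xs n) C xpredT x =
  \sum_b (group_size (lab n) b)%:R * cmass b (xsection C x).
Proof.
move=> mC; rewrite -sum_over_labels /mean_hits.
by apply: eq_bigr => i _; exact: hit_prob_class.
Qed.

Lemma mean_hits_class n (C : set (borel S * borel S)) x : measurable C ->
  mean_hits P (xs n) C [pred i | lab n i == theta] x =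
  (group_size (lab n) theta)%:R * cmass theta (xsection C x).
Proof.
move=> mC; rewrite /mean_hits /= (eq_bigr (fun=> cmass theta (xsection C x))).
  by rewrite sumr_const mulr_natl.
by move=> i /eqP <-; exact: hit_prob_class.
Qed.

Context (delta : R) (delta_bounds : 0 < delta <= 4^-1).

Let delta0 : 0 < delta. Proof. by case/andP: delta_bounds. Qed.

Definition typical_sizes n : Prop :=
  forall b, `|(group_size (lab n) b)%:R / n%:R - w b| <= delta * w b.

(** The expected counts differ from their limiting values only through the group
    sizes, which are within a factor [1 +- delta] of [n * w b]. *)
Lemma expected_counts_close n (C : set (borel S * borel S)) x : (0 < n)%N ->
  typical_sizes n -> measurable C ->
  let v := n%:R * mass mu C x in
  let vt := n%:R * (w theta * cmass theta (xsection C x)) in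
  `|mean_hits P (xs n) C xpredT x - v| <= delta * v /\
  `|mean_hits P (xs n) C [pred i | lab n i == theta] x - vt| <= delta * v.
Proof.
move=> n0 tn mC v vt; have mCx : measurable (xsection C x) by exact: measurable_xsection.
have massE : mass mu C x = \sum_b w b * cmass b (xsection C x).
  by rewrite /mass (feature_mass mX mY prior_gt0).
have w0 b : 0 < w b by exact: prior_gt0.
have c0 b : 0 <= cmass b (xsection C x) by exact: class_mass_ge0.
have nR : 0 < n%:R :> R by rewrite ltr0n.
have sz b : `|(group_size (lab n) b)%:R - n%:R * w b| <= delta * (n%:R * w b).
  rewrite (_ : _ - _ = n%:R * ((group_size (lab n) b)%:R / n%:R - w b)).
    by rewrite normrM (ger0_norm (ltW nR)) mulrCA ler_pM2l.
  by rewrite mulrBr mulrCA mulfV ?mulr1// gt_eqF.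
have term b : `|(group_size (lab n) b)%:R * cmass b (xsection C x) -
    n%:R * (w b * cmass b (xsection C x))| <=
    delta * (n%:R * (w b * cmass b (xsection C x))).
  rewrite mulrA -mulrBl normrM (ger0_norm (c0 b)).
  by apply: le_trans (ler_wpM2r (c0 b) (sz b)) _; rewrite !mulrA.
split.
  rewrite mean_hits_all// /v massE !mulr_sumr -sumrB.
  by apply: le_trans (ler_norm_sum _ _ _) _; apply: ler_sum => b _; exact: term.
rewrite mean_hits_class//; apply: le_trans (term theta) _.
rewrite ler_pM2l// /v ler_pM2l// massE (bigD1 theta)//= lerDl sumr_ge0// => b _.
by rewrite mulr_ge0// ltW.
Qed.

(* The value [2^-1] is only a placeholder for small [n]: by [p_near] the first
   branch is eventually taken. *)
Let p n : R := let q := (1 + 4 * delta) * (k n)%:R / n%:R in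
  if 0 < q < 1 then q else 2^-1.

Let p01 n : 0 < p n < 1.
Proof.
rewrite /p; case: ifP => // _.
by apply/andP; split; rlra.
Qed.

(* The closed balls for [cl = true], the open ones for [cl = false]. *)
Let ball_graph (cl : bool) n : set (borel S * borel S) :=
  if cl then [set z | dist z.1 z.2 <= qradius dist mu (p n) z.1]
  else [set z | dist z.1 z.2 < qradius dist mu (p n) z.1].

Let in_ball (cl : bool) n (x y : S) : bool :=
  if cl then dist x y <= qradius dist mu (p n) x
  else dist x y < qradius dist mu (p n) x.

Lemma measurable_ball_graph cl n : measurable (ball_graph cl n).
Proof.
have mr : measurable_fun setT (fun z : borel S * borel S => qradius dist mu (p n) z.1).
  apply: (measurableT_comp _ measurable_fst).
  by apply: measurable_qradius => //; case/andP: (p01 n).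
have md := measurable_dist Hd.
by rewrite /ball_graph; case: cl; [exact: measurable_setle|exact: measurable_setlt].
Qed.

Lemma indic_ball_graph cl n x y : \1_(ball_graph cl n) (x, y) = (in_ball cl n x y)%:R :> R.
Proof.
rewrite indicE /ball_graph /in_ball; congr (_%:R); congr nat_of_bool.
by case: cl; apply/idP/idP => [/set_mem//|h]; rewrite inE.
Qed.

Lemma hits_all cl n om : hits (R := R) X (xs n) (ball_graph cl n) xpredT om =
  #|[pred i | in_ball cl n (X om) (xs n i om)]|%:R.
Proof.
by rewrite card_natrE /hits; apply: eq_bigr => i _; rewrite indic_ball_graph.
Qed.

Lemma hits_class cl n om :
  hits (R := R) X (xs n) (ball_graph cl n) [pred i | lab n i == theta] om =
  #|[pred i | (lab n i == theta) && in_ball cl n (X om) (xs n i om)]|%:R.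
Proof.
rewrite card_natrE /hits big_mkcond; apply: eq_bigr => i _ /=.
by case: (lab n i == theta) => //=; rewrite indic_ball_graph.
Qed.

Let osc cl n (x : borel S) : \bar R :=
  (\int[mu]_y (avg_kernel mu (p n) (ball_graph cl n) (x, y) * `|u y - u x|)%:E)%E.

Let deviation cl n (I : pred 'I_n) : set Omega :=
  [set om | delta * scale P (xs n) (ball_graph cl n) (k n)%:R (X om)
     <= `|hits (R := R) X (xs n) (ball_graph cl n) I om
          - mean_hits P (xs n) (ball_graph cl n) I (X om)|].

(* A count that is far from its conditional expectation, or a center about
   which the posterior oscillates. *)
Let bad cl n : set Omega :=
  deviation cl (xpredT : pred 'I_n) `|` deviation cl [pred i : 'I_n | lab n i == theta]
  `|` X @^-1` [set x | (delta%:E <= osc cl n x)%E].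

(** Outside the bad events all the hypotheses of [knn_weight_close] hold. *)
Lemma knn_weight_good n om : (0 < k n <= n)%N ->
  p n = (1 + 4 * delta) * (k n)%:R / n%:R -> typical_sizes n ->
  ~ bad true n om -> ~ bad false n om ->
  `|knn_weight dist (fun i => xs n i om) (lab n) (k n) theta (X om) - u (X om)|
    <= 84 * delta.
Proof.
move=> k0n pE tn good_c good_o.
have /andP[p0 p1] := p01 n.
have n0 : (0 < n)%N by case/andP: k0n => k0; exact: leq_trans.
have nR : 0 < n%:R :> R by rewrite ltr0n.
have npE : n%:R * p n = (1 + 4 * delta) * (k n)%:R.
  by rewrite pE mulrCA mulfV ?mulr1// gt_eqF.
set x := X om; pose v cl := n%:R * mass mu (ball_graph cl n) x.
pose vt cl := n%:R * (w theta * cmass theta (xsection (ball_graph cl n) x)).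
have close cl : ~ bad cl n om -> counts_close (k n) delta (u x) (v cl) (vt cl)
    (mean_hits P (xs n) (ball_graph cl n) xpredT x)
    (mean_hits P (xs n) (ball_graph cl n) [pred i | lab n i == theta] x)
    #|[pred i | in_ball cl n x (xs n i om)]|%:R
    #|[pred i | (lab n i == theta) && in_ball cl n x (xs n i om)]|%:R.
  move=> g; have mC := measurable_ball_graph cl n.
  have g1 : `|hits (R := R) X (xs n) (ball_graph cl n) xpredT om
      - mean_hits P (xs n) (ball_graph cl n) xpredT x|
      < delta * scale P (xs n) (ball_graph cl n) (k n)%:R x.
    by rewrite ltNge; apply/negP => h; apply: g; left; left.
  have g2 : `|hits (R := R) X (xs n) (ball_graph cl n) [pred i | lab n i == theta] om
      - mean_hits P (xs n) (ball_graph cl n) [pred i | lab n i == theta] x|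
      < delta * scale P (xs n) (ball_graph cl n) (k n)%:R x.
    by rewrite ltNge; apply/negP => h; apply: g; left; right.
  have g3 : (osc cl n x < delta%:E)%E.
    by rewrite ltNge; apply/negP => h; apply: g; right.
  have [e1 e2] := expected_counts_close x n0 tn mC.
  split; [exact: e1|exact: e2| | |].
  - have ob := oscillation_bound mY prior_gt0 f_gt0 mf f_density (p01 n) mC
      (ltW delta0) (ltW g3).
    rewrite /vt /v [u x * _]mulrCA -mulrBr normrM (ger0_norm (ltW nR)).
    apply: (le_trans (ler_wpM2l (ltW nR) ob)).
    rewrite mulrCA ler_pM2l// maxr_pMr ?(ltW nR)// npE ge_max le_max [X in _ && X]le_max lexx orbT andbT.
    apply/orP; left; rewrite ler_wpM2r//.
    by case/andP: delta_bounds => _ ?; rlra.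
  - by rewrite -hits_all ltW.
  - by rewrite -hits_class ltW.
have xsec cl : mu (xsection (ball_graph cl n) x) = (mass mu (ball_graph cl n) x)%:E.
  by rewrite massE//; exact: measurable_ball_graph.
apply: (@knn_weight_close _ _ _ Hd _ _ _ _ _ _ k0n x delta (u x) (qradius dist mu (p n) x)
  (v true) (vt true) _ _ (v false) (vt false) _ _ delta_bounds _ _ _ _
  (close true good_c) (close false good_o)).
- exact: posterior01.
- exact: qradius_ge0.
- rewrite /v -npE ler_pM2l// -lee_fin -xsec xsectionE.
  exact: (cball_qradius Hd mu p1).
- apply/andP; split; first by rewrite /v mulr_ge0 ?mass_ge0 ?(ltW nR).
  rewrite /v -npE ler_pM2l// -lee_fin -xsec xsectionE.
  exact: (oball_qradius Hd mu x (ltW p0)).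
Qed.

Lemma measurable_osc_at cl n : measurable_fun setT (osc cl n).
Proof.
apply: (measurable_fun_fubini_tonelli_F (m2 := mu)
  (fun z => (avg_kernel mu (p n) (ball_graph cl n) z * `|u z.2 - u z.1|)%:E)).
  apply/measurable_EFinP; apply: measurable_funM.
    by apply: measurable_avg_kernel => //; exact: measurable_ball_graph.
  have mU := measurable_posterior prior_gt0 f_gt0 mf theta.
  apply: measurableT_comp => //; apply: measurable_funB.
    exact: (measurableT_comp mU measurable_snd).
  exact: (measurableT_comp mU measurable_fst).
by move=> z; rewrite lee_fin mulr_ge0//; exact: avg_kernel_ge0.
Qed.

Lemma measurable_bad cl n : measurable (bad cl n).
Proof.
have mC := measurable_ball_graph cl n.
apply: measurableU; first by apply: measurableU; exact: measurable_deviation.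
rewrite -[X in measurable X]setTI; apply: mX => //; rewrite -[X in measurable X]setTI.
by apply: emeasurable_fun_c_infty => //; exact: measurable_osc_at.
Qed.

Let mean_osc cl n : \bar R :=
  mean_oscillation mu (avg_kernel mu (p n) (ball_graph cl n)) u.

(** Chebyshev for the two counts and Markov for the oscillation. *)
Lemma bad_le cl n : (0 < k n)%N ->
  (P (bad cl n) <= ((delta ^+ 2 * (k n)%:R)^-1 *+ 2)%:E + (delta^-1)%:E * mean_osc cl n)%E.
Proof.
move=> k0; have k0R : 0 < (k n)%:R :> R by rewrite ltr0n.
have mC := measurable_ball_graph cl n.
have mo := measurable_osc_at cl n.
have mset : measurable ([set x | (delta%:E <= osc cl n x)%E] : set (borel S)).
  by rewrite -[X in measurable X]setTI; exact: emeasurable_fun_c_infty.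
have mXset : measurable (X @^-1` [set x | (delta%:E <= osc cl n x)%E]).
  by rewrite -[X in measurable X]setTI; exact: mX.
have conc (I : pred 'I_n) := hits_concentration mX (@mxs n) (@indep n) mC k0R I delta0.
have mdev (I : pred 'I_n) : measurable (deviation cl I) by exact: measurable_deviation.
apply: (le_trans (measureU2 P (measurableU _ _ (mdev _) (mdev _)) mXset)).
apply: leeD.
  apply: (le_trans (measureU2 P (mdev _) (mdev _))).
  by rewrite mulr2n EFinD; apply: leeD; exact: conc.
apply: (ge0_markov mu delta0 mo) => x; apply: integral_ge0 => y _.
by rewrite lee_fin mulr_ge0//; exact: avg_kernel_ge0.
Qed.

Hypothesis sizes : \forall n \near \oo, typical_sizes n.
Hypothesis k_oo : k n @[n --> \oo] --> \oo.
Hypothesis k_o_n : (k n)%:R / n%:R @[n --> \oo] --> (0 : R).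
Hypothesis regular : continuous u \/
  (exists2 g, 0 <= g & bounded_overlap dist mu g).

Let p_near : \forall n \near \oo, p n = (1 + 4 * delta) * (k n)%:R / n%:R.
Proof.
have c0 : 0 < 1 + 4 * delta by move: delta0; rlra.
have c10 : 0 < (1 + 4 * delta)^-1 / 2 by rewrite divr_gt0 ?invr_gt0.
have /cvgrPdist_le/(_ _ c10) kn := k_o_n.
near=> n; rewrite /p ifT//.
have k0n : (0 < k n <= n)%N by near: n; exact: k_bounds.
have /andP[k0 _] := k0n.
have n0 : (0 < n)%N by case/andP: k0n => ?; exact: leq_trans.
have kn' : `|0 - (k n)%:R / n%:R| <= (1 + 4 * delta)^-1 / 2 by near: n; exact: kn.
have q0 : 0 < (k n)%:R / n%:R :> R by rewrite divr_gt0 ?ltr0n.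
apply/andP; split; first by rewrite -mulrA mulr_gt0.
rewrite sub0r normrN ger0_norm ?(ltW q0)// in kn'.
rewrite -mulrA; apply: (@le_lt_trans _ _ ((1 + 4 * delta) * ((1 + 4 * delta)^-1 / 2))).
  by rewrite ler_pM2l.
by rewrite mulrA mulfV ?gt_eqF//; rlra.
Unshelve. all: by end_near. Qed.

Let p_cvg0 : p n @[n --> \oo] --> (0 : R).
Proof.
suff : (1 + 4 * delta) * (k n)%:R / n%:R @[n --> \oo] --> (0 : R).
  by apply: cvg_trans; apply: near_eq_cvg; apply: filterS p_near => n ->.
rewrite -[X in _ --> X](mulr0 (1 + 4 * delta)).
under eq_fun do rewrite -mulrA.
by apply: cvgM => //; exact: cvg_cst.
Qed.

Let mean_osc_cvg cl : mean_osc cl n @[n --> \oo] --> 0%E.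
Proof.
apply: (mean_oscillation_cvg0 Hd (mu := mu) p01 p_cvg0 (measurable_ball_graph cl)).
- move=> n z; rewrite /ball_graph; case: cl => //=; exact: ltW.
- exact: measurable_posterior.
- exact: posterior01.
- exact: regular.
Qed.

Lemma knn_statistic_deviation_cvg (eps : R) : 84 * delta < eps ->
  P [set om | (eps <= `|knn_statistic dist (fun i => xs n i om) (lab n) (k n) theta (X om)
     - - u (X om)|)%R] @[n --> \oo] --> 0%E.
Proof.
move=> deps; apply: cvge0P => [n|e e0]; first exact: measure_ge0.
have e4 : 0 < e / 4 by rewrite divr_gt0.
have de4 : 0 < delta * (e / 4) by rewrite mulr_gt0.
have o1 := cvge0_near (mean_osc_cvg true) de4.
have o2 := cvge0_near (mean_osc_cvg false) de4.
pose K := (Num.truncn (delta ^+ 2 * (e / 4) / 2)^-1).+1.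
have kK : \forall n \near \oo, (K <= k n)%N by exact: (k_oo (nbhs_infty_ge K)).
apply: filterS (filterI (filterI k_bounds kK)
  (filterI (filterI p_near sizes) (filterI o1 o2))).
move=> n [[k0n kn] [[pE ts] [m1 m2]]].
have k0 : (0 < k n)%N by case/andP: k0n.
have bl cl : (P (bad cl n) <= (e / 2)%:E)%E.
  apply: le_trans (bad_le cl k0) _.
  rewrite (_ : e / 2 = e / 4 + e / 4) ?EFinD; last by field.
  apply: leeD.
    rewrite lee_fin.
    have k0R : 0 < (k n)%:R :> R by rewrite ltr0n.
    have d20 : 0 < delta ^+ 2 by rewrite exprn_gt0.
    have c0 : 0 < delta ^+ 2 * (e / 4) / 2 by rewrite divr_gt0// mulr_gt0.
    have : (delta ^+ 2 * (e / 4) / 2)^-1 <= (k n)%:R.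
      apply: (@le_trans _ _ K%:R); first by rewrite ltW// truncnS_gt.
      by rewrite ler_nat; exact: kn.
    rewrite -[in X in X -> _](invrK (k n)%:R) lef_pV2 ?posrE ?invr_gt0// => kk.
    rewrite -mulr2n (_ : (delta ^+ 2 * (k n)%:R)^-1 = (delta ^+ 2)^-1 * (k n)%:R^-1);
      last by rewrite invfM.
    rewrite -[X in X <= _]mulr_natr.
    apply: (@le_trans _ _ ((delta ^+ 2)^-1 * (delta ^+ 2 * (e / 4) / 2) * 2)).
      by rewrite ler_pM2r// ler_pM2l ?invr_gt0.
    rewrite (_ : (delta ^+ 2)^-1 * (delta ^+ 2 * (e / 4) / 2) * 2 = e / 4)//.
    by field; rewrite gt_eqF.
  apply: (@le_trans _ _ ((delta^-1)%:E * (delta * (e / 4))%:E)%E).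
    apply: lee_wpmul2l; first by rewrite lee_fin invr_ge0 ltW.
    by case: cl; [exact: m1|exact: m2].
  by rewrite -EFinM lee_fin mulKf ?gt_eqF.
set E := [set om | _].
have mE : measurable E.
  apply: measurable_setle; first exact: measurable_cst.
  apply: measurableT_comp => //; apply: measurable_funB.
    exact: (measurable_knn_statistic Hd mX (@mxs n) k0n).
  apply: measurable_funN; apply: (measurableT_comp _ mX).
  exact: measurable_posterior.
have sub : E `<=` bad true n `|` bad false n.
  move=> om Eom; apply: contrapT => /not_orP[g1 g2].
  have := knn_weight_good k0n pE ts g1 g2; move: Eom; rewrite /E /= /knn_statistic.
  rewrite -opprD normrN => h1 h2.
  by have := le_lt_trans (le_trans h1 h2) deps; rewrite ltxx.
apply: (@le_trans _ _ (P (bad true n `|` bad false n))).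
  apply: le_measure; rewrite ?inE//.
  by apply: measurableU; exact: measurable_bad.
apply: (le_trans (measureU2 P (measurable_bad true n) (measurable_bad false n))).
by rewrite (splitr e) EFinD; apply: leeD; exact: bl.
Qed.

End knn_convergence.

(** * The two kinds of feature spaces *)

Lemma mdist_metrizes (R : realType) (S : pmetricType R) : separable S ->
  metrizes (S := S) (fun x y : S => mdist x y : R).
Proof.
move=> [D cD dD].
have open_mdist (x : S) (r : R) : open [set y : S | mdist x y < r].
  rewrite openE => y /= xy; rewrite /interior; apply/nbhs_ballP.
  exists (r - mdist x y); first by rewrite /= subr_gt0.
  move=> z; rewrite ballEmdist /= => yz.
  by apply: le_lt_trans (metric_triangle x y z) _; rewrite -ltrBrDl.
split.
- exact: mdistxx.
- exact: mdist_positivity.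
- exact: metric_sym.
- by move=> x y z; exact: metric_triangle.
- exact: open_mdist.
- move=> U x oU Ux; have /nbhs_ballP[r /= r0 rU] : nbhs x U by exact: open_nbhs_nbhs.
  by exists r => //; rewrite -ballEmdist.
- have [q qD] := countable_enum cD; exists q => x r r0.
  have [y [xy Dy]] : [set y : S | mdist x y < r] `&` D !=set0.
    by apply: dD; [exists x; rewrite /= mdistxx|exact: open_mdist].
  by have [n qn] := qD y Dy; exists n; rewrite qn metric_sym.
Qed.

Lemma feature_space_metrizes (R : realType) (L : nat) (S : ptopologicalType)
    (dist : S -> S -> R) (f : 'I_L -> S -> R) :
  feature_space dist f -> metrizes dist.
Proof.
by case=> [S' f' sS _|q N f' nN]; [exact: mdist_metrizes|exact: norm_metrizes].
Qed.

Lemma feature_space_regular (R : realType) (L : nat) (S : ptopologicalType)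
    (dist : S -> S -> R) (f : 'I_L -> S -> R) : feature_space dist f ->
  (forall b, continuous (f b)) \/
  (forall mu : probability (borel S) R, exists2 g, 0 <= g & bounded_overlap dist mu g).
Proof.
case=> [S' f' _ cf|q N f' nN]; first by left.
by right=> mu; exact: norm_bounded_overlap.
Qed.

Lemma posterior_continuous (R : realType) (L : nat) (S : ptopologicalType)
    (w : 'I_L -> R) (f : 'I_L -> S -> R) (theta : 'I_L) :
  (forall b, 0 < w b) -> (forall b x, 0 < f b x) -> (forall b, continuous (f b)) ->
  continuous (posterior w f theta).
Proof.
move=> w0 f0 cf x; apply: cvgM.
  by apply: cvgM; [exact: cvg_cst|exact: cf].
apply: cvgV.
  rewrite gt_eqF// (bigD1 theta)//= ltr_pwDl ?mulr_gt0// sumr_ge0// => b _.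
  by rewrite mulr_ge0// ltW.
elim: (index_enum _) => [|b r IH].
  rewrite big_nil; under eq_fun do rewrite big_nil.
  exact: cvg_cst.
rewrite big_cons; under eq_fun do rewrite big_cons.
by apply: cvgD => //; apply: cvgM; [exact: cvg_cst|exact: cf].
Qed.

Lemma posterior_Tstar (R : realType) (L : nat) (S : Type)
    (w : 'I_L -> R) (f : 'I_L -> S -> R) (theta : 'I_L) x :
  (forall b x, 0 < f b x) -> 0 < \sum_(c < L | c != theta) w c ->
  posterior w f theta x =
  w theta / (w theta + (\sum_(c < L | c != theta) w c) * Tstar w f theta x).
Proof.
move=> f0 c0; rewrite /posterior (bigD1 theta)//=; set c := \sum_(_ < _ | _) w _.
have -> : c * Tstar w f theta x = (\sum_(b < L | b != theta) w b * f b x) / f theta x.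
  rewrite /Tstar mulr_sumr mulr_suml; apply: eq_bigr => b _.
  by rewrite /rel_weight -/c; field; rewrite !gt_eqF.
set s := \sum_(_ < _ | _) _.
have -> : w theta + s / f theta x = (w theta * f theta x + s) / f theta x.
  by field; rewrite gt_eqF.
by rewrite invfM invrK mulrCA mulrA mulrC mulrA.
Qed.

(** * Consistency of the nearest neighbor statistic *)

(** The likelihood ratio determines the posterior through the decreasing map
    [s |-> w theta / (w theta + c * s)], with [c] the total weight of the other
    classes; its opposite is the transformation [h]. Convergence within [eps]
    comes from the deviation bound [84 * delta] for a small enough [delta]. *)
Theorem lemma3p3
  (R : realType) (L : nat) (L_ge2 : (2 <= L)%N)
  (* feature space, distance, densities: condition (a) or (b) *)
  (S : ptopologicalType) (dist : S -> S -> R) (f : 'I_L -> S -> R)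
  (HS : feature_space dist f)
  (* the random pair (X, Y) *)
  (d : measure_display) (Omega : measurableType d) (P : probability Omega R)
  (X : Omega -> borel S) (mX : measurable_fun setT X)
  (Y : Omega -> 'I_L) (mY : forall b, measurable (Y @^-1` [set b]))
  (prior_gt0 : forall b, 0 < prior P Y b)
  (M : {measure set (borel S) -> \bar R})
  (f_gt0 : forall b x, 0 < f b x)
  (mf : forall b, measurable_fun setT (f b : borel S -> R))
  (f_density : forall b (A : set (borel S)), measurable A ->
     class_law P Y X b A = (\int[M]_(x in A) (f b x)%:E)%E)
  (Tstar_atomless : forall (theta : 'I_L) (t : R),
     P [set omega | Tstar (prior P Y) f theta (X omega) = t] = 0%E)
  (* training data: fixed labels and random features, for each sample size n *)
  (lab : forall n : nat, 'I_n -> 'I_L)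
  (xs : forall n : nat, 'I_n -> Omega -> borel S)
  (mxs : forall n i, measurable_fun setT (xs n i))
  (xs_indep : forall n, sample_independent P Y X (xs n))
  (xs_law : forall n i (A : set (borel S)), measurable A ->
     P (xs n i @^-1` A) = class_law P Y X (lab n i) A)
  (group_gt0 : \forall n \near \oo, forall b, (0 < group_size (lab n) b)%N)
  (group_freq : forall b,
     (group_size (lab n) b)%:R / n%:R @[n --> \oo] --> prior P Y b)
  (* number of neighbors, a function of the group sizes *)
  (k : ('I_L -> nat) -> nat)
  (k_bounds : \forall n \near \oo, (0 < k (group_size (lab n)) <= n)%N)
  (k_oo : k (group_size (lab n)) @[n --> \oo] --> \oo)
  (k_o_n : (k (group_size (lab n)))%:R / n%:R @[n --> \oo] --> (0 : R))
  (theta : 'I_L) :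
  (* - knn_weight lies in [-1, 0] and Tstar is positive: the limit is Tstar up to
     a strictly increasing transformation h, which is determined explicitly on
     the values of Tstar *)
  exists h : R -> R,
    [/\ forall s t : R, 0 < s -> s < t -> h s < h t,
        forall x : S,
          h (Tstar (prior P Y) f theta x) = - posterior (prior P Y) f theta x
      & cvg_in_probability P
          (fun n omega => knn_statistic dist (fun i => xs n i omega) (lab n)
                            (k (group_size (lab n))) theta (X omega))
          (fun omega => h (Tstar (prior P Y) f theta (X omega)))].
Proof.
have w0 b : 0 < prior P Y b by exact: prior_gt0.
set c := \sum_(b < L | b != theta) prior P Y b.
have c0 : 0 < c.
  have [b bt] : exists b : 'I_L, b != theta.
    have /card_gt0P[b bt] : (0 < #|predC1 theta|)%N.
      by rewrite cardC1 card_ord -subn1 subn_gt0.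
    by exists b.
  by rewrite /c (bigD1 b)//= ltr_pwDl// sumr_ge0// => b' _; exact: ltW.
exists (fun s => - (prior P Y theta / (prior P Y theta + c * s))); split.
- move=> s t s0 st; have t0 := lt_trans s0 st.
  rewrite ltrN2 ltr_pM2l// ltf_pV2 ?posrE ?addr_gt0 ?mulr_gt0//.
  by rewrite ltrD2l ltr_pM2l.
- by move=> x; rewrite (posterior_Tstar _ f_gt0).
- rewrite [X in cvg_in_probability _ _ X](_ : _ =
    fun om => - posterior (prior P Y) f theta (X om)); last first.
    by apply/funext => om; rewrite (posterior_Tstar _ f_gt0).
  move=> eps eps0.
  have Hd := feature_space_metrizes HS.
  pose delta : R := Num.min 4^-1 (eps / 85).
  have delta_bounds : 0 < delta <= 4^-1.
    by rewrite /delta lt_min ge_min lexx/= andbT invr_gt0 ltr0n divr_gt0.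
  have deps : 84 * delta < eps.
    have : delta <= eps / 85 by rewrite /delta ge_min lexx orbT.
    by move: eps0; rlra.
  have reg : continuous (posterior (prior P Y) f theta) \/
      exists2 g, 0 <= g & bounded_overlap dist (law P mX) g.
    by case: (feature_space_regular HS) => [cf|ov]; [left; exact: posterior_continuous|right; exact: ov].
  have sizes : \forall n \near \oo, typical_sizes P Y lab delta n.
    apply: filter_forall => b.
    have /cvgrPdist_le/(_ (delta * prior P Y b)) := group_freq b.
    have /andP[delta0 _] := delta_bounds.
    move=> /(_ (mulr_gt0 delta0 (w0 b))); apply: filterS => n.
    by rewrite distrC.
  exact: (@knn_statistic_deviation_cvg R L S dist f Hd d Omega P X mX Y mY prior_gt0 M
    f_gt0 mf f_density theta lab xs mxs xs_indep xs_law
    (fun n => k (group_size (lab n))) k_bounds delta delta_bounds sizes k_oo k_o_n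
    reg eps deps).
Qed.
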